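(* Let $\mu,\nu\in\mathcal{P}(\mathcal{X})$, $\varepsilon>0$, and $c:\mathcal{X}\times\mathcal{X}\to\mathbb{R}_+$ measurable with $\int c\,d\mu\otimes\nu<\infty$. Assume there exist $p>0$ and $\delta>0$ such that \[ \lim_{r\to\infty}\frac{\sup_{x,y\in B_r}c(x,y)}{r^p}=0\quad\text{and}\quad\lim_{r\to\infty}\frac{\max\{\mu(\mathcal{X}\setminus B_r),\nu(\mathcal{X}\setminus B_r)\}}{\exp(-r^{p+\delta})}=0 . \] Let $g_1^*,g_2^*$, $\pi^*$, and the Sinkhorn iterates $g_1^{(n)},g_2^{(n)},\pi^{(n)}$ be as in the context. Then there exist parameters $0<m_1\le m_2$ and tail functions $\alpha_1,\tilde\alpha_1$ defining a cone $\mathcal{G}^{\mu}_{\alpha_1,\tilde\alpha_1}$, parameters $0<m_1'\le m_2'$ and tail functions $\alpha_2,\tilde\alpha_2$ defining a cone $\mathcal{G}^{\nu}_{\alpha_2,\tilde\alpha_2}$, and numbers $A>0$, $\kappa\in(0,1)$ such that for all $n\in\mathbb{N}$, \[ d_{\mathcal{G}^{\mu}_{\alpha_1,\tilde\alpha_1}}\big(g_1^*,g_1^{(n)}\big)+d_{\mathcal{G}^{\nu}_{\alpha_2,\tilde\alpha_2}}\big(g_2^*,g_2^{(n)}\big)\le A\kappa^n \quad\text{and}\quad \|\pi^{(n)}-\pi^*\|_{TV}\le A\kappa^n . \]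
   Context: $\mathcal{X}$ is a Polish space with metric $d_{\mathcal{X}}$, $x_0\in\mathcal{X}$ fixed, $B_r=\{x: d_{\mathcal{X}}(x_0,x)\le r\}$, $B_r^{\mathsf c}=\mathcal{X}\setminus B_r$. Entropic optimal transport: minimize $\int c\,d\pi+\varepsilon H(\pi,\mu\otimes\nu)$ over couplings $\pi$ of $\mu,\nu$ ($H$ relative entropy). Its unique optimizer $\pi^*$ has density $\frac{d\pi^*}{d\mu\otimes\nu}(x,y)=e^{-c(x,y)/\varepsilon}g_1^*(x)g_2^*(y)$, where $g_1^*,g_2^*>0$ are measurable solutions of the Schrödinger equations $g_1^*=T_\nu(g_2^* )$, $g_2^*=T_\mu(g_1^* )$, with $T_\nu(g)(x)=\big(\int e^{-c(x,y)/\varepsilon}g(y)\,\nu(dy)\big)^{-1}$ and $T_\mu(g)(y)=\big(\int e^{-c(x,y)/\varepsilon}g(x)\,\mu(dx)\big)^{-1}$. Sinkhorn's algorithm: $g_1^{(0)}=g_2^{(0)}\equiv1$, $g_1^{(n+1)}=T_\nu(g_2^{(n)})$, $g_2^{(n+1)}=T_\mu(g_1^{(n+1)})$, and $\frac{d\pi^{(n)}}{d\mu\otimes\nu}(x,y)=e^{-c(x,y)/\varepsilon}g_1^{(n)}(x)g_2^{(n)}(y)$. $\|\cdot\|_{TV}$ is the total variation norm (here $\|\pi^{(n)}-\pi^*\|_{TV}$ is the $L^1(\mu\otimes\nu)$-distance of the densities). A tail function is a non-increasing $\alpha:(0,\infty)\to[0,\infty)$ with $\lim_{r\to\infty}\alpha(r)=0$.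 For $\rho\in\mathcal{P}(\mathcal{X})$, $0<m_1\le m_2$ and tail functions $\alpha,\tilde\alpha$ (standing assumptions $\rho(B_{m_1})>0$, $\alpha>0$): $\mathcal{F}^{\rho}_{\alpha,\tilde\alpha}$ is the set of $f\in L^2(\rho)$ with $f\mathbf 1_{B_{m_2}}\ge0$ $\rho$-a.s., $\int_{B_r^{\mathsf c}}f_+d\rho\le\alpha(r)\int fd\rho$ for $r\ge m_1$, $\int_{B_r^{\mathsf c}}f_-d\rho\le\tilde\alpha(r)\int fd\rho$ for $r\ge m_2$; $\mathcal{G}^{\rho}_{\alpha,\tilde\alpha}=\{g\in L^2(\rho):\int fg\,d\rho\ge0\ \forall f\in\mathcal{F}^{\rho}_{\alpha,\tilde\alpha}\}$. Hilbert's metric for a cone $C$: $f\le_C g$ iff $g-f\in C$; $f\sim_C g$ iff each dominates the other ($f\le_C bg$ for some $b>0$, and vice versa); $M(f,g)=\inf\{b>0:bg-f\in C\}$, $m(f,g)=\sup\{a>0:f-ag\in C\}$; $d_C(f,g)=\log(M/m)$ if $f\sim_C g$, $g\ne0$, and $\infty$ otherwise. *)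

(* Defs.v *)
From HB Require Import structures.
From mathcomp Require Import all_boot all_order all_algebra.
From mathcomp Require Import all_classical all_reals all_analysis.
Set Implicit Arguments. Unset Strict Implicit. Unset Printing Implicit Defensive.
Import Order.TTheory GRing.Theory Num.Theory.
Import numFieldNormedType.Exports.
Local Open Scope classical_set_scope.
Local Open Scope ring_scope.

Section defs.
Context {R : realType}.

Section metric.
Context {d : measure_display} {X : measurableType d}.
Variable dX : X -> X -> R.

Definition is_metric : Prop :=
  [/\ (forall x y, 0 <= dX x y),
      (forall x y, dX x y = 0 <-> x = y),
      (forall x y, dX x y = dX y x) &
      (forall x y z, dX x z <= dX x y + dX y z)].

Definition metric_open (A : set X) : Prop :=
  forall x, A x -> exists e : R, 0 < e /\ [set y | dX x y < e] `<=` A.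

Definition metric_separable : Prop :=
  exists u : nat -> X, forall x (e : R), 0 < e -> exists n, dX x (u n) < e.

Definition metric_complete : Prop :=
  forall u : nat -> X,
    (forall e : R, 0 < e -> exists N, forall m n, (N <= m)%N -> (N <= n)%N ->
        dX (u m) (u n) < e) ->
    exists l, forall e : R, 0 < e -> exists N, forall n, (N <= n)%N -> dX (u n) l < e.

Definition polish_borel : Prop :=
  [/\ is_metric, metric_separable, metric_complete &
      (forall A : set X, measurable A <-> <<s metric_open >> A)].

Definition ball_r (x0 : X) (r : R) : set X := [set x | dX x0 x <= r].
End metric.

Definition tail_function (alpha : R -> R) : Prop :=
  [/\ (forall r s, 0 < r -> r <= s -> alpha s <= alpha r),
      (forall r, 0 < r -> 0 <= alpha r) &
      alpha r @[r --> +oo] --> (0 : R)].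

Section cones.
Context {d : measure_display} {X : measurableType d}.
Variables (rho : {measure set X -> \bar R}) (B : R -> set X).

Definition L2 (f : X -> R) : Prop :=
  measurable_fun setT f /\ (\int[rho]_x ((f x) ^+ 2)%:E < +oo)%E.

Definition coneF (m1 m2 : R) (alpha alphat : R -> R) : set (X -> R) :=
  [set f | [/\ L2 f,
     {ae rho, forall x, B m2 x -> 0 <= f x},
     (forall r, m1 <= r ->
        (\int[rho]_(x in ~` B r) (Num.max (f x) 0)%:E
          <= (alpha r)%:E * \int[rho]_x (f x)%:E)%E) &
     (forall r, m2 <= r ->
        (\int[rho]_(x in ~` B r) (Num.max (- f x) 0)%:E
          <= (alphat r)%:E * \int[rho]_x (f x)%:E)%E)]].

Definition coneG (m1 m2 : R) (alpha alphat : R -> R) : set (X -> R) :=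
  [set g | L2 g /\
     forall f, coneF m1 m2 alpha alphat f -> (0 <= \int[rho]_x (f x * g x)%:E)%E].

(* Hilbert's projective metric of a cone C (elements compared up to
   rho-null sets only through the condition "g <> 0 in L^2(rho)") *)
Definition cone_le (C : set (X -> R)) (f g : X -> R) : Prop :=
  C (fun x => g x - f x).

Definition cone_equiv (C : set (X -> R)) (f g : X -> R) : Prop :=
  (exists b : R, 0 < b /\ cone_le C f (fun x => b * g x)) /\
  (exists b : R, 0 < b /\ cone_le C g (fun x => b * f x)).

Definition hM (C : set (X -> R)) (f g : X -> R) : R :=
  inf [set b : R | 0 < b /\ C (fun x => b * g x - f x)].

Definition hm (C : set (X -> R)) (f g : X -> R) : R :=
  sup [set a : R | 0 < a /\ C (fun x => f x - a * g x)].

Definition hilbert_dist (C : set (X -> R)) (f g : X -> R) : \bar R :=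
  if `[< cone_equiv C f g /\ ~ {ae rho, forall x, g x = 0} >]
  then (ln (hM C f g / hm C f g))%:E
  else +oo%E.
End cones.

Section sinkhorn.
Context {d : measure_display} {X : measurableType d}.
Variables (mu nu : {measure set X -> \bar R}) (c : X * X -> R) (eps : R).

Definition T_nu (g : X -> R) (x : X) : R :=
  let I := (\int[nu]_y (expR (- c (x, y) / eps) * g y)%:E)%E in
  if I == +oo%E then 0 else (fine I)^-1.

Definition T_mu (g : X -> R) (y : X) : R :=
  let I := (\int[mu]_x (expR (- c (x, y) / eps) * g x)%:E)%E in
  if I == +oo%E then 0 else (fine I)^-1.

Fixpoint sinkhorn (n : nat) : (X -> R) * (X -> R) :=
  match n with
  | 0 => (fun _ => 1, fun _ => 1)
  | n.+1 => let g1 := T_nu (sinkhorn n).2 in (g1, T_mu g1)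
  end.

(* density d pi / d(mu x nu) associated with a pair of potentials *)
Definition plan_density (g1 g2 : X -> R) (z : X * X) : R :=
  expR (- c z / eps) * g1 z.1 * g2 z.2.
End sinkhorn.

End defs.

(* Main.v *)
(* With E = exp ((L + d(x0, .)^p) / eps) the kernel k = exp (-c / eps) satisfies
   1 / (E(x) E(y)) <= k <= 1, and E^3 is integrable for both marginals. Every
   potential T(g) = 1 / int k g is pinched between multiples a and a Q E, with Q
   uniform along the algorithm.

   By Gibbs' inequality, ln T(u) - ln T(v) lies between the averages of ln v - ln u
   under the two tilted Markov kernels k u / int k u and k v / int k v. These kernels
   satisfy a drift condition for the Lyapunov function E^2 and a common minorization
   on its sublevel sets, so as in Harris' theorem T contracts the weighted oscillation
   inf_l sup |ln u - ln v - l| / (1 + beta E^2) by a fixed factor. Hence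
   ln g^(n) - ln g^* decays geometrically in this seminorm.

   The cones are taken with alphat = 0 and alpha decaying so fast that every f in F is
   nonnegative with int f E^3 <= C int f. Then Gibbs' inequality for the measure f rho
   turns the weighted bound into a bound on Hilbert's metric, and
   |e^a - e^b| <= |a - b| (e^a + e^b) turns it into the L^1 bound. *)

Require Import Defs.
From HB Require Import structures.
From mathcomp Require Import all_boot all_order all_algebra.
From mathcomp Require Import all_classical all_reals all_analysis.
From mathcomp Require Import measurable_realfun ring lra.
Set Implicit Arguments.
Unset Strict Implicit.
Unset Printing Implicit Defensive.
Import Order.TTheory GRing.Theory Num.Theory.
Import numFieldNormedType.Exports.
Local Open Scope classical_set_scope.
Local Open Scope ring_scope.

(** * Integrals and Gibbs' inequality *)

(** The lower bound on [k] fixes the powers of [E]. The mass of a tilted kernel at [y] can be as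
    small as a multiple of [1 / E y], so its averages are only controlled up to a factor [E y]; a
    Lyapunov function must grow faster than [E] to absorb this, and [E^2] does. A potential may
    itself be as large as [E], whence the moment of [E^3]. The exponent [delta] gives exponential
    moments of [d(x0, .)^p] of every order, so any fixed power of [E] is affordable.

    The two directions of Gibbs' inequality use different kernels. These need not be close: each
    dominates the same multiple of [1 / E], so both bounds have the same centre.

    The contraction factor depends only on [J], a bound on the moments, and [Q], which [T]
    preserves; hence it is the same at every step. The estimates are pointwise while the
    Schroedinger equations hold almost everywhere, so the given potentials are first replaced by
    versions solving them everywhere. *)

Section integral.
Context {R : realType} {d : measure_display} {T : measurableType d}.
Variable mu : {measure set T -> \bar R}.
Implicit Types (f g h U V : T -> R).
Local Notation igr f := (mu.-integrable setT (EFin \o f)).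

Lemma igr_le f g : measurable_fun setT f -> igr g ->
  (forall x, `|f x| <= g x) -> igr f.
Proof.
move=> mf ig fg; apply: (le_integrable measurableT _ _ ig).
  exact/measurable_EFinP.
move=> x _ /=; rewrite lee_fin; exact: le_trans (fg x) (ler_norm _).
Qed.

Lemma igrD f g : igr f -> igr g -> igr (fun x => f x + g x).
Proof. by move=> i1 i2; exact: (integrableD measurableT i1 i2). Qed.

Lemma igrZ r f : igr f -> igr (fun x => r * f x).
Proof. by move=> i1; exact: (integrableZl measurableT r i1). Qed.

Lemma igrB f g : igr f -> igr g -> igr (fun x => f x - g x).
Proof. by move=> i1 i2; exact: (integrableB measurableT i1 i2). Qed.

Lemma igr_meas f : igr f -> measurable_fun setT f.
Proof. by move=> /integrableP[/measurable_EFinP]. Qed.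

Lemma RintD f g : igr f -> igr g ->
  \int[mu]_x (f x + g x) = \int[mu]_x f x + \int[mu]_x g x.
Proof. by move=> ? ?; exact: RintegralD. Qed.

Lemma RintB f g : igr f -> igr g ->
  \int[mu]_x (f x - g x) = \int[mu]_x f x - \int[mu]_x g x.
Proof. by move=> ? ?; exact: RintegralB. Qed.

Lemma RintZ r f : igr f -> \int[mu]_x (r * f x) = r * \int[mu]_x f x.
Proof. by move=> ?; exact: RintegralZl. Qed.

Lemma Rint_le f g : igr f -> igr g -> (forall x, f x <= g x) ->
  \int[mu]_x f x <= \int[mu]_x g x.
Proof. by move=> ? ? fg; apply: le_Rintegral. Qed.

(* Gibbs' variational inequality; the only property of the exponential used is
   [1 + t <= expR t]. *)
Lemma gibbs U V h m : (forall x, 0 <= U x) ->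
  (forall x, V x = U x * expR (- h x)) ->
  igr U -> igr V -> igr (fun x => U x * h x) ->
  \int[mu]_x (U x * h x) <= m * \int[mu]_x U x ->
  \int[mu]_x U x <= expR m * \int[mu]_x V x.
Proof.
move=> U0 VE iU iV iUh Hm.
have : \int[mu]_x ((1 + m) * U x - U x * h x) <= \int[mu]_x (expR m * V x).
  apply: Rint_le; [by apply: igrB => //; exact: igrZ|exact: igrZ|].
  move=> x; rewrite VE mulrCA -expRD.
  apply: (@le_trans _ _ (U x * (1 + (m - h x)))); first by lra.
  by rewrite ler_wpM2l// expR_ge1Dx.
rewrite RintB//; last exact: igrZ.
rewrite !RintZ//; lra.
Qed.

End integral.

Section reciprocal.
Context {R : realType} {d : measure_display} {T : measurableType d}.

Lemma measurable_recip (f : T -> R) : measurable_fun setT f ->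
  (forall x, 0 < f x) -> measurable_fun setT (fun x => (f x)^-1).
Proof.
move=> mf f0; have -> : (fun x => (f x)^-1) = (fun x => expR (- ln (f x))).
  by apply/funext => x; rewrite expRN lnK// posrE.
apply: measurableT_comp => //; apply: measurableT_comp => //.
by apply: measurableT_comp mf; exact: measurable_ln.
Qed.

End reciprocal.

Section probability_integral.
Context {R : realType} {d : measure_display} {X : measurableType d}.
Variable m : probability X R.

Lemma ae_exists (P : X -> Prop) : {ae m, forall x, P x} -> exists x, P x.
Proof.
move=> [N [mN mN0 NE]]; apply: contrapT => nP.
have NT : N = setT by rewrite -subTset => x _; apply: NE => /= Px; apply: nP; exists x.
have : m setT = 0%E by rewrite -NT; exact: mN0.
have -> : m setT = 1%E by exact: probability_setT.
by move/eqP; rewrite onee_eq0.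
Qed.

Lemma Rint_gt0 (g : X -> R) : (forall x, 0 < g x) ->
  m.-integrable setT (EFin \o g) -> 0 < \int[m]_x g x.
Proof.
move=> g0 ig; rewrite lt_neqAle Rintegral_ge0 ?andbT; last by move=> x _; exact: ltW.
apply/eqP => /esym I0.
have mg := igr_meas ig.
have I0' : (\int[m]_x `|(EFin \o g) x| = 0)%E.
  under eq_integral do rewrite gee0_abs ?lee_fin ?(ltW (g0 _))//.
  have /fineK <- := integrable_fin_num measurableT ig.
  by rewrite -[fine _]/(Rintegral m setT g) I0.
have : ae_eq m setT (EFin \o g) (cst 0%E).
  by apply/ae_eq_integral_abs => //; exact/measurable_EFinP.
by move=> /ae_exists[x /(_ I)[] /eqP]; rewrite gt_eqF.
Qed.

Lemma Rint_cst (r : R) : \int[m]_x r = r.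
Proof.
rewrite Rintegral_cst// [X in fine X](_ : _ = 1%E) ?mulr1//.
exact: probability_setT.
Qed.

End probability_integral.

(** * Contraction of tilted kernels *)

Section weighted_contraction.
Context {R : realType} {d : measure_display} {X : measurableType d}.
Variables (mu : probability X R) (E : X -> R) (J : R).
Hypothesis mE : measurable_fun setT E.
Hypothesis E1 : forall x, 1 <= E x.
Hypothesis iE3 : mu.-integrable setT (EFin \o (fun x => E x ^+ 3)).
Hypothesis E3J : \int[mu]_x (E x ^+ 3) <= J.
Local Notation igr f := (mu.-integrable setT (EFin \o f)).

Let E0 x : 0 < E x. Proof. exact: lt_le_trans ltr01 (E1 x). Qed.
Let EV1 x : (E x)^-1 <= 1. Proof. by rewrite invf_le1. Qed.
Let EV0 x : 0 < (E x)^-1. Proof. by rewrite invr_gt0. Qed.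

Lemma weight_pow_le x n : (n <= 3)%N -> E x ^+ n <= E x ^+ 3.
Proof. by move=> n3; apply: ler_weXn2l. Qed.

Lemma tame_integrable (f : X -> R) (C : R) : measurable_fun setT f ->
  (forall x, `|f x| <= C * E x ^+ 3) -> igr f.
Proof. by move=> mf fC; apply: igr_le fC => //; exact: igrZ. Qed.

Lemma measurable_weightV : measurable_fun setT (fun x => (E x)^-1).
Proof. exact: measurable_recip. Qed.

Lemma weight_integrable n : (n <= 3)%N -> igr (fun x => E x ^+ n).
Proof.
move=> n3; apply: (@tame_integrable _ 1) => [|x].
  exact: measurable_funX.
by rewrite mul1r ger0_norm ?weight_pow_le// exprn_ge0 // ltW.
Qed.

Lemma weightV_integrable : igr (fun x => (E x)^-1).
Proof.
apply: (@tame_integrable _ 1); first exact: measurable_weightV.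
move=> x; rewrite mul1r (ger0_norm (ltW (EV0 x))); apply: (le_trans (EV1 x)).
by rewrite exprn_ege1.
Qed.

Lemma weight_pow_int n : (n <= 3)%N -> \int[mu]_x (E x ^+ n) <= J.
Proof.
move=> n3; apply: le_trans E3J; apply: Rint_le => [||x].
- exact: weight_integrable.
- exact: weight_integrable.
- exact: weight_pow_le.
Qed.

Lemma J_ge1 : 1 <= J.
Proof.
have := @weight_pow_int 0 isT.
by under eq_Rintegral do rewrite expr0; rewrite Rint_cst.
Qed.

(* Tangent line of [t |-> 1 / t] at [t = J]. *)
Lemma weightV_int_ge : J^-1 <= \int[mu]_x (E x)^-1.
Proof.
have J0 : 0 < J by apply: lt_le_trans J_ge1.
have i1 : igr (fun=> 2 / J).
  have J2 : 0 <= 2 / J by rewrite divr_ge0// ltW.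
  apply: (@tame_integrable _ (2 / J)) => // x.
  by rewrite (ger0_norm J2) ler_peMr// exprn_ege1.
have iE : igr E by exact: (@weight_integrable 1).
have : \int[mu]_x (2 / J - (J ^+ 2)^-1 * E x) <= \int[mu]_x (E x)^-1.
  apply: Rint_le => [||x].
  - by apply: igrB => //; exact: igrZ.
  - exact: weightV_integrable.
  have -> : 2 / J - (J ^+ 2)^-1 * E x = (E x)^-1 - (E x - J) ^+ 2 / (J ^+ 2 * E x).
    by field; rewrite !gt_eqF//=.
  rewrite lerBlDr lerDl divr_ge0 ?sqr_ge0// mulr_ge0 ?sqr_ge0//; exact: ltW.
apply: le_trans.
rewrite RintB//; last exact: igrZ.
rewrite (RintZ ((J ^+ 2)^-1) iE) Rint_cst.
have := @weight_pow_int 1 isT; rewrite [X in X <= _ -> _](_ : _ = \int[mu]_x E x)//.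
move=> H.
have : (J ^+ 2)^-1 * \int[mu]_x E x <= (J ^+ 2)^-1 * J.
  by rewrite ler_wpM2l// invr_ge0 sqr_ge0.
have -> : (J ^+ 2)^-1 * J = J^-1 by field; rewrite gt_eqF.
lra.
Qed.

Lemma weightV_int_le : \int[mu]_x (E x)^-1 <= 1.
Proof.
rewrite -[leRHS](Rint_cst mu 1); apply: Rint_le => //; first exact: weightV_integrable.
exact: (@weight_integrable 0).
Qed.

(** The scale [a] stays existential because potentials are only determined up to a factor; [Q] is
    the part that must be uniform along the iteration. *)
Definition tempered (Q : R) (u : X -> R) : Prop :=
  measurable_fun setT u /\
  exists2 a, 0 < a & forall x, a <= u x <= a * (Q * E x).

(** * Drift and minorization for one tilted kernel: [k] is the kernel at a fixed point [y], and [e]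
    is [E y] *)

Section kernel.
Variables (Q : R) (k : X -> R) (e : R).
Hypothesis Q1 : 1 <= Q.
Hypothesis mk : measurable_fun setT k.
Hypothesis k0 : forall x, 0 < k x.
Hypothesis k1 : forall x, k x <= 1.
Hypothesis e1 : 1 <= e.
Hypothesis kE : forall x, (E x * e)^-1 <= k x.

Let J0 : 0 < J. Proof. exact: lt_le_trans J_ge1. Qed.
Let Q0 : 0 < Q. Proof. exact: lt_le_trans Q1. Qed.
Let e0 : 0 < e. Proof. exact: lt_le_trans e1. Qed.

Lemma kernel_integrable u n : tempered Q u -> (n <= 2)%N ->
  igr (fun x => k x * u x * E x ^+ n).
Proof.
move=> [mu_ [a a0 au]] n2; apply: (@tame_integrable _ (a * Q)) => [|x].
  by apply: measurable_funM; [exact: measurable_funM|exact: measurable_funX].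
have /andP[aux uxa] := au x.
have u0 : 0 <= u x by apply: le_trans aux; exact: ltW.
rewrite ger0_norm; last first.
  by rewrite mulr_ge0 ?mulr_ge0 ?exprn_ge0// ltW.
apply: (@le_trans _ _ (1 * (a * (Q * E x)) * E x ^+ 2)); last by rewrite mul1r; lra.
apply: ler_pM => //; [|exact: exprn_ge0 (ltW _)| |exact: ler_weXn2l].
- by rewrite mulr_ge0// ltW.
- by apply: ler_pM => //; exact: ltW.
Qed.

Lemma mass_integrable u : tempered Q u -> igr (fun x => k x * u x).
Proof.
move=> tu; have := @kernel_integrable u 0 tu isT.
by under eq_fun do rewrite expr0 mulr1.
Qed.

Lemma mass_ge u a : tempered Q u -> 0 < a -> (forall x, a <= u x) ->
  a / (J * e) <= \int[mu]_x (k x * u x).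
Proof.
move=> tu a0 au.
apply: (@le_trans _ _ (\int[mu]_x ((a / e) * (E x)^-1))).
  rewrite RintZ; last exact: weightV_integrable.
  have -> : a / (J * e) = a / e * J^-1 by field; rewrite !gt_eqF.
  by rewrite ler_wpM2l ?weightV_int_ge// divr_ge0// ltW.
apply: Rint_le; [exact: igrZ weightV_integrable|exact: mass_integrable|move=> x].
have -> : a / e * (E x)^-1 = (E x * e)^-1 * a by field; rewrite !gt_eqF.
by apply: ler_pM => //; rewrite ?invr_ge0 ?mulr_ge0// ltW.
Qed.

Lemma mass_le u a : tempered Q u -> 0 < a ->
  (forall x, 0 <= u x <= a * (Q * E x)) ->
  \int[mu]_x (k x * u x) <= a * (Q * J).
Proof.
move=> tu a0 au.
apply: (@le_trans _ _ (\int[mu]_x ((a * Q) * E x ^+ 1))).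
  apply: Rint_le; [exact: mass_integrable|exact/igrZ/weight_integrable|move=> x].
  have /andP[u0 ua] := au x.
  by rewrite -mulrA expr1 -[leRHS]mul1r; apply: ler_pM => //; exact: ltW.
rewrite RintZ ?weight_integrable// mulrA ler_wpM2l ?weight_pow_int//.
by rewrite mulr_ge0// ltW.
Qed.

Lemma mass_gt0 u : tempered Q u -> 0 < \int[mu]_x (k x * u x).
Proof.
move=> tu; have [_ [a a0 au]] := tu.
apply: (lt_le_trans _ (@mass_ge u a tu a0 _)) => [|x].
  by rewrite divr_gt0 ?mulr_gt0.
by case/andP : (au x).
Qed.

Definition drift_cst := (Q * J ^+ 2) ^+ 2.

(** The left side is at most [a Q J] and the mass at least [a / (J e)], so the tilted average of
    [E^2] is at most [q e] with [q = Q J^2]. This is linear in [e], and [q e <= e^2 / 4 + q^2]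
    trades it for a small multiple of the Lyapunov function plus [drift_cst = q^2]. *)
Lemma drift u : tempered Q u ->
  \int[mu]_x (k x * u x * E x ^+ 2) <=
  (e ^+ 2 / 4 + drift_cst) * \int[mu]_x (k x * u x).
Proof.
move=> tu; have [mu_ [a a0 au]] := tu.
have H1 : \int[mu]_x (k x * u x * E x ^+ 2) <= a * Q * J.
  apply: (@le_trans _ _ (\int[mu]_x ((a * Q) * E x ^+ 3))).
    apply: Rint_le; [exact: kernel_integrable|exact: igrZ|move=> x].
    have /andP[aux uxa] := au x.
    have kua : k x * u x <= a * Q * E x.
      rewrite -[X in _ <= X]mulrA -[leRHS]mul1r; apply: ler_pM => //; first exact: ltW.
      by apply: le_trans aux; exact: ltW.
    have -> : a * Q * E x ^+ 3 = a * Q * E x * E x ^+ 2 by ring.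
    by apply: ler_wpM2r => //; exact: sqr_ge0.
  by rewrite RintZ// ler_wpM2l// mulr_ge0// ltW.
have H2 : a / (J * e) <= \int[mu]_x (k x * u x).
  by apply: mass_ge => // x; case/andP : (au x).
apply: (le_trans H1).
apply: (@le_trans _ _ (Q * J ^+ 2 * e * (a / (J * e)))).
  by rewrite le_eqVlt; apply/orP; left; apply/eqP; field; rewrite !gt_eqF.
apply: ler_pM => //.
- by rewrite !mulr_ge0 ?exprn_ge0// ltW.
- by rewrite divr_ge0 ?mulr_ge0// ltW.
have := sqr_ge0 (e / 2 - Q * J ^+ 2).
rewrite /drift_cst; set q := Q * J ^+ 2; lra.
Qed.

(** The minorization is used where [e^2 <= level_cst], and there removes at least the fraction
    [minor_cst] of the mass. [weight_cst] is the beta of the seminorm, tuned so that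
    [weight_cst * drift_cst = minor_cst / 2]: half of the gain pays for the drift constant, the
    other half is the rate. The remaining factor in [level_cst] makes [weight_cst * level_cst = 4 *
    minor_cst * (1 + J + J^2)], exactly what the case of large [e] consumes. *)
Definition level_cst := 8 * drift_cst * (1 + J + J ^+ 2).
Definition minor_cst := (Q * J ^+ 2 * level_cst)^-1.
Definition weight_cst := minor_cst / (2 * drift_cst).
Definition contr_cst := 1 - minor_cst / 2.

Lemma drift_cst_ge1 : 1 <= drift_cst.
Proof. by rewrite exprn_ege1// mulr_ege1 ?exprn_ege1 ?J_ge1. Qed.

Lemma level_cst_ge1 : 1 <= level_cst.
Proof.
rewrite /level_cst; have := drift_cst_ge1; have := J_ge1 => ? ?.
have J2 : 1 <= J ^+ 2 by exact: exprn_ege1.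
by rewrite mulr_ege1//; lra.
Qed.

Lemma minor_cst_gt0 : 0 < minor_cst.
Proof.
have l0 : 0 < level_cst by apply: lt_le_trans level_cst_ge1.
by rewrite invr_gt0 (mulr_gt0 (mulr_gt0 Q0 (exprn_gt0 2 J0)) l0).
Qed.

Lemma minor_cst_le1 : minor_cst <= 1.
Proof.
have H : 1 <= Q * J ^+ 2 * level_cst.
  by apply: mulr_ege1 level_cst_ge1; rewrite mulr_ege1 ?exprn_ege1 ?J_ge1.
by rewrite invf_le1// (lt_le_trans _ H).
Qed.

Lemma weight_cst_gt0 : 0 < weight_cst.
Proof.
have l0 : 0 < drift_cst by apply: lt_le_trans drift_cst_ge1.
by rewrite divr_gt0 ?minor_cst_gt0// (mulr_gt0 _ l0).
Qed.

Lemma weight_cst_drift : weight_cst * drift_cst = minor_cst / 2.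
Proof.
by rewrite /weight_cst; field; rewrite gt_eqF// (lt_le_trans _ drift_cst_ge1).
Qed.

Lemma weight_cst_le1 : weight_cst <= 1.
Proof.
have := weight_cst_drift; have := drift_cst_ge1; have := minor_cst_le1.
have := weight_cst_gt0; nra.
Qed.

Lemma contr_cst_itv : 0 < contr_cst < 1.
Proof.
have := minor_cst_gt0; have := minor_cst_le1; rewrite /contr_cst => ? ?.
by apply/andP; split; lra.
Qed.

(** * Averages of a log-ratio [h] under one tilted kernel *)

Section step.
Variables (u h : X -> R) (lam th : R).
Hypothesis tu : tempered Q u.
Hypothesis mh : measurable_fun setT h.
Hypothesis th0 : 0 <= th.
Hypothesis hE : forall x, `|h x - lam| <= th * (1 + weight_cst * E x ^+ 2).

Let be0 := weight_cst_gt0.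

Lemma kernel_log_integrable : igr (fun x => k x * u x * (h x - lam)).
Proof.
have ku0 x : 0 <= k x * u x.
  have [_ [a a0 au]] := tu; have /andP[aux _] := au x.
  by rewrite mulr_ge0 ?(ltW (k0 x))//; apply: le_trans aux; exact: ltW.
apply: (@igr_le _ _ _ _ _ (fun x => th * (1 + weight_cst) * (k x * u x * E x ^+ 2))).
- apply: measurable_funM; last exact: measurable_funB.
  exact: igr_meas (mass_integrable tu).
- exact/igrZ/kernel_integrable.
move=> x; rewrite normrM (ger0_norm (ku0 x)).
apply: (@le_trans _ _ (k x * u x * (th * (1 + weight_cst * E x ^+ 2)))).
  exact: ler_wpM2l.
have -> : th * (1 + weight_cst) * (k x * u x * E x ^+ 2) =
          k x * u x * (th * (E x ^+ 2 + weight_cst * E x ^+ 2)) by ring.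
apply: ler_wpM2l => //; apply: ler_wpM2l => //.
by rewrite lerD2r exprn_ege1.
Qed.

Lemma weightV_log_integrable : igr (fun x => (E x)^-1 * (h x - lam)).
Proof.
apply: (@tame_integrable _ (th * (1 + weight_cst))) => [|x].
  by apply: measurable_funM; [exact: measurable_weightV|exact: measurable_funB].
rewrite normrM (ger0_norm (ltW (EV0 x))).
apply: (@le_trans _ _ (1 * (th * (1 + weight_cst * E x ^+ 2)))).
  by apply: ler_pM => //; exact: ltW.
rewrite mul1r -mulrA ler_wpM2l// mulrDl mul1r lerD ?exprn_ege1//.
by rewrite ler_wpM2l ?(ltW be0)// weight_pow_le.
Qed.

(* Without the minorization: this keeps the centering constant [lam]. *)
Lemma kernel_log_drift :
  \int[mu]_x (k x * u x * (h x - lam)) <=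
  th * (1 + weight_cst * (e ^+ 2 / 4 + drift_cst)) * \int[mu]_x (k x * u x).
Proof.
have ku0 x : 0 <= k x * u x.
  have [_ [a a0 au]] := tu; have /andP[aux _] := au x.
  by rewrite mulr_ge0 ?(ltW (k0 x))//; apply: le_trans aux; exact: ltW.
have ik := mass_integrable tu.
have iV := @kernel_integrable u 2 tu isT.
apply: (@le_trans _ _ (\int[mu]_x (th * (k x * u x) +
   th * weight_cst * (k x * u x * E x ^+ 2)))).
  apply: Rint_le; [exact: kernel_log_integrable|by apply: igrD; exact: igrZ|].
  move=> x; apply: (@le_trans _ _ (k x * u x * (th * (1 + weight_cst * E x ^+ 2)))).
    by apply: ler_wpM2l => //; apply: le_trans (hE x); exact: ler_norm.
  by rewrite le_eqVlt; apply/orP; left; apply/eqP; ring.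
rewrite RintD; [|exact: igrZ|exact: igrZ].
rewrite !RintZ//.
have -> : th * (1 + weight_cst * (e ^+ 2 / 4 + drift_cst)) * \int[mu]_x (k x * u x)
  = th * \int[mu]_x (k x * u x) + th * weight_cst *
    ((e ^+ 2 / 4 + drift_cst) * \int[mu]_x (k x * u x)) by ring.
rewrite lerD2l ler_wpM2l ?drift// mulr_ge0//; exact: ltW.
Qed.

(* The shift of the center is the integral against the common minorant
   [minor_cst * J / E] of the tilted kernels. *)
Definition center_shift := minor_cst * J * \int[mu]_x ((E x)^-1 * (h x - lam)).

(** Against the density [1 / E] the weight [1 + E^2] becomes [1 / E + E], with integral at most
    [1 + J]. The bound is the price of using the shifted centre also at points where no minorization
    is available. *)
Lemma center_shift_le : `|center_shift| <= minor_cst * (J * (1 + J)) * th.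
Proof.
rewrite /center_shift normrM ger0_norm; last first.
  by rewrite mulr_ge0 ?(ltW minor_cst_gt0)// ltW.
rewrite mulrA -!mulrA; apply: ler_wpM2l; first exact: ltW minor_cst_gt0.
apply: ler_wpM2l; first exact: ltW.
have iL := weightV_log_integrable.
apply: le_trans (le_normr_Rintegral measurableT iL) _.
apply: (@le_trans _ _ (\int[mu]_x (th * (E x)^-1 + th * E x ^+ 1))).
  apply: Rint_le.
  - exact: integrable_norm iL.
  - by apply: igrD; apply: igrZ; [exact: weightV_integrable|exact: weight_integrable].
  move=> x; rewrite normrM (ger0_norm (ltW (EV0 x))).
  apply: (@le_trans _ _ ((E x)^-1 * (th * (1 + 1 * E x ^+ 2)))).
    apply: ler_wpM2l; first exact: ltW.
    apply: le_trans (hE x) _; apply: ler_wpM2l => //; rewrite lerD2l.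
    by apply: ler_wpM2r; [exact: sqr_ge0|exact: weight_cst_le1].
  by rewrite le_eqVlt; apply/orP; left; apply/eqP; field; rewrite gt_eqF.
rewrite RintD; [|exact/igrZ/weightV_integrable|exact/igrZ/weight_integrable].
rewrite !RintZ; [|exact: weight_integrable|exact: weightV_integrable].
rewrite (mulrC _ th) -mulrDr ler_wpM2l// lerD ?weightV_int_le//.
exact: weight_pow_int.
Qed.

(** Split [s / E] off from [k u]. The split part contributes exactly [center_shift * Z], where
    [center_shift] involves neither [k] nor [u]; the rest is a nonnegative measure of mass at most
    [(1 - minor_cst) * Z], on which [hE] is applied. *)
Lemma kernel_log_minor : e ^+ 2 <= level_cst ->
  \int[mu]_x (k x * u x * (h x - lam)) <=
  (center_shift + th * (1 - minor_cst + weight_cst * (e ^+ 2 / 4 + drift_cst)))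
  * \int[mu]_x (k x * u x).
Proof.
move=> eR.
have al0 := minor_cst_gt0.
set Z := \int[mu]_x (k x * u x).
have Z0 : 0 < Z by exact: mass_gt0.
have [mu_ [a a0 au]] := tu.
have ZaQJ : Z <= a * (Q * J).
  apply: mass_le => // x; have /andP[ax ->] := au x.
  by rewrite andbT; apply: le_trans ax; exact: ltW.
pose s := minor_cst * J * Z.
have s0 : 0 < s by rewrite !mulr_gt0.
(* This inequality dictates [minor_cst]: [Z <= a Q J], and [e <= e^2 <= level_cst] because
   [e >= 1]. *)
have sE : s <= a / e.
  have eL : e <= level_cst.
    by apply: le_trans eR; rewrite expr2 ler_peMl// ltW.
  have l0 : 0 < level_cst by apply: lt_le_trans level_cst_ge1.
  apply: (@le_trans _ _ (minor_cst * J * (a * (Q * J)))).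
    by apply: ler_wpM2l => //; rewrite mulr_ge0// ltW.
  have -> : minor_cst * J * (a * (Q * J)) = a / level_cst.
    by rewrite /minor_cst; field; rewrite !gt_eqF.
  by rewrite ler_wpM2l ?(ltW a0)// lef_pV2 ?posrE.
have kus x : s * (E x)^-1 <= k x * u x.
  have /andP[ax _] := au x.
  apply: (@le_trans _ _ ((E x * e)^-1 * a)).
    have -> : (E x * e)^-1 * a = a / e * (E x)^-1 by field; rewrite !gt_eqF.
    by apply: ler_wpM2r => //; exact: ltW.
  by apply: ler_pM => //; rewrite ?invr_ge0 ?mulr_ge0// ltW.
have ik := mass_integrable tu.
have iV := @kernel_integrable u 2 tu isT.
have iE := weightV_integrable.
have iL := weightV_log_integrable.
have iK := kernel_log_integrable.
have iE1 := @weight_integrable 1 isT.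
have H : \int[mu]_x (k x * u x * (h x - lam) - s * ((E x)^-1 * (h x - lam))) <=
   \int[mu]_x ((th * (k x * u x) + th * weight_cst * (k x * u x * E x ^+ 2))
                - th * s * (E x)^-1).
  apply: Rint_le.
  - by apply: igrB => //; exact: igrZ.
  - by apply: igrB; [apply: igrD; exact: igrZ|exact: igrZ].
  move=> x.
  apply: (@le_trans _ _ ((k x * u x - s * (E x)^-1) *
            (th * (1 + weight_cst * E x ^+ 2)))).
    rewrite [leLHS](_ : _ = (k x * u x - s * (E x)^-1) * (h x - lam)); last by ring.
    apply: ler_wpM2l; first by rewrite subr_ge0.
    by apply: le_trans (hE x); exact: ler_norm.
  (* The split part lowers the mass term and the [E^2] term; only the saving in mass is kept. *)
  have : 0 <= s * (E x)^-1 * (th * (weight_cst * E x ^+ 2)).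
    apply: mulr_ge0; first by apply: mulr_ge0; exact: ltW.
    by apply: mulr_ge0 => //; apply: mulr_ge0; [exact: ltW|exact: sqr_ge0].
  by lra.
move: H; rewrite RintB//; last exact: igrZ.
rewrite RintB; [|by apply: igrD; exact: igrZ|exact: igrZ].
rewrite RintD; [|exact: igrZ|exact: igrZ].
rewrite !RintZ// -/Z => H.
have HD : th * weight_cst * \int[mu]_x (k x * u x * E x ^+ 2) <=
    th * weight_cst * ((e ^+ 2 / 4 + drift_cst) * Z).
  by rewrite ler_wpM2l ?drift// mulr_ge0// ltW.
(* Here the factor [J] in [s] pays off: since [1 / E] has integral at least [1 / J], the removed
   mass is at least [minor_cst * Z]. *)
have HV : th * s * J^-1 <= th * s * \int[mu]_x (E x)^-1.
  by rewrite ler_wpM2l ?weightV_int_ge// mulr_ge0// ltW.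
have sJ : th * s * J^-1 = th * minor_cst * Z.
  by rewrite /s; field; rewrite gt_eqF.
have sC : s * \int[mu]_x ((E x)^-1 * (h x - lam)) = center_shift * Z.
  by rewrite /s /center_shift; ring.
move: H HD HV; rewrite sJ sC; lra.
Qed.

(** For [e^2 <= level_cst] the minorization gains [minor_cst], half of which covers the drift
    constant. For larger [e] the drift replaces [weight_cst * e^2] by a quarter of it, and this
    surplus pays both for the rate and for a centre shift that does not help there. The centre is
    the same in both cases, hence the same for all [y]. *)
Lemma kernel_log_contraction :
  \int[mu]_x (k x * u x * h x) <=
  (lam + center_shift + contr_cst * th * (1 + weight_cst * e ^+ 2))
  * \int[mu]_x (k x * u x).
Proof.
have ik := mass_integrable tu.
have -> : \int[mu]_x (k x * u x * h x) =
    \int[mu]_x (k x * u x * (h x - lam) + lam * (k x * u x)).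
  by apply: eq_Rintegral => x _; ring.
rewrite RintD; [|exact: kernel_log_integrable|exact: igrZ].
rewrite RintZ//; set Z := \int[mu]_x (k x * u x).
have Z0 : 0 < Z by exact: mass_gt0.
suff : \int[mu]_x (k x * u x * (h x - lam)) <=
    (center_shift + contr_cst * th * (1 + weight_cst * e ^+ 2)) * Z by lra.
have bK := weight_cst_drift; have al0 := minor_cst_gt0; have al1 := minor_cst_le1.
have be0' := be0.
have e2 : 0 <= e ^+ 2 by exact: sqr_ge0.
have be2 : 0 <= weight_cst * e ^+ 2 by rewrite mulr_ge0// ltW.
have [eR|eR] := leP (e ^+ 2) level_cst.
  apply: le_trans (kernel_log_minor eR) _.
  rewrite -/Z ler_wpM2r ?(ltW Z0)// lerD2l.
  have -> : contr_cst * th * (1 + weight_cst * e ^+ 2) =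
    th * (contr_cst * (1 + weight_cst * e ^+ 2)) by ring.
  apply: ler_wpM2l => //.
  rewrite mulrDr bK /contr_cst.
  have : minor_cst * (weight_cst * e ^+ 2) <= 1 * (weight_cst * e ^+ 2).
    by rewrite ler_wpM2r.
  lra.
apply: le_trans kernel_log_drift _.
rewrite -/Z ler_wpM2r ?(ltW Z0)//.
have := center_shift_le; rewrite ler_norml => /andP[cl _].
suff : th * (1 + weight_cst * (e ^+ 2 / 4 + drift_cst) +
    minor_cst * (J * (1 + J))) <= th * (contr_cst * (1 + weight_cst * e ^+ 2)).
  by lra.
rewrite ler_wpM2l// mulrDr bK /contr_cst.
have H1 : weight_cst * level_cst <= weight_cst * e ^+ 2.
  by rewrite ler_wpM2l ?ltW// ltW.
have H2 : weight_cst * level_cst = 4 * minor_cst * (1 + J + J ^+ 2).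
  have -> : weight_cst * level_cst = 8 * (weight_cst * drift_cst) * (1 + J + J ^+ 2).
    by rewrite /level_cst; ring.
  by rewrite bK; field.
have H3 : minor_cst * (weight_cst * e ^+ 2) <= 1 * (weight_cst * e ^+ 2).
  by rewrite ler_wpM2r.
move: H1; rewrite H2; lra.
Qed.

End step.

End kernel.

End weighted_contraction.

(** * The Sinkhorn map *)

Section scaling_map.
Context {R : realType} {d : measure_display} {X : measurableType d}.
Variables (mu nu : probability X R) (c : X * X -> R) (eps : R).
Variables (E : X -> R) (J Q : R).
Hypothesis eps0 : 0 < eps.
Hypothesis c0 : forall z, 0 <= c z.
Hypothesis mc : measurable_fun setT c.
Hypothesis mE : measurable_fun setT E.
Hypothesis E1 : forall x, 1 <= E x.
Hypothesis imu : mu.-integrable setT (EFin \o (fun x => E x ^+ 3)).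
Hypothesis muJ : \int[mu]_x (E x ^+ 3) <= J.
Hypothesis inu : nu.-integrable setT (EFin \o (fun x => E x ^+ 3)).
Hypothesis nuJ : \int[nu]_x (E x ^+ 3) <= J.
Hypothesis cE : forall x y, (E x * E y)^-1 <= expR (- c (x, y) / eps).
Local Notation kap x y := (expR (- c (x, y) / eps)).
Local Notation T := (T_mu mu c eps).
Local Notation igr m f := (m.-integrable setT (EFin \o f)).

Let E0 x : 0 < E x. Proof. exact: lt_le_trans ltr01 (E1 x). Qed.
Let J1 : 1 <= J. Proof. exact: (J_ge1 mE E1 imu muJ). Qed.
Let J0 : 0 < J. Proof. exact: lt_le_trans J1. Qed.

Lemma kap_gt0 x y : 0 < kap x y. Proof. exact: expR_gt0. Qed.

Lemma kap_le1 x y : kap x y <= 1.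
Proof. by rewrite expR_le1 mulNr oppr_le0 divr_ge0// ltW. Qed.

Lemma measurable_gibbs_kernel : measurable_fun setT (fun z => expR (- c z / eps)).
Proof.
apply: measurableT_comp => //; apply: measurable_funM => //.
exact: measurableT_comp.
Qed.

Lemma measurable_kernel1 y : measurable_fun setT (fun x => kap x y).
Proof. exact: (measurableT_comp measurable_gibbs_kernel (pair2_measurable y)). Qed.

Lemma measurable_plan_density (u v : X -> R) : measurable_fun setT u ->
  measurable_fun setT v -> measurable_fun setT (plan_density c eps u v).
Proof.
move=> mu_ mv; apply: measurable_funM.
  apply: measurable_funM; first exact: measurable_gibbs_kernel.
  exact: measurableT_comp mu_ measurable_fst.
exact: measurableT_comp mv measurable_snd.
Qed.

Lemma weighted_integrable (m : probability X R) (g : X -> R) :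
  (forall x, 0 < g x) -> igr m g -> igr m (fun x => (E x)^-1 * g x).
Proof.
move=> g0 ig; apply: (igr_le _ ig) => [|x].
  by apply: measurable_funM; [exact: measurable_recip|exact: igr_meas ig].
rewrite ger0_norm ?mulr_ge0 ?invr_ge0 ?(ltW (g0 x)) ?(ltW (E0 x))//.
by rewrite ler_piMl ?(ltW (g0 x))// invf_le1.
Qed.

Lemma kernel_mass_integrable (g : X -> R) y :
  (forall x, 0 < g x) -> igr mu g -> igr mu (fun x => kap x y * g x).
Proof.
move=> g0 ig; apply: (igr_le _ ig) => [|x].
  by apply: measurable_funM; [exact: measurable_kernel1|exact: igr_meas ig].
rewrite ger0_norm ?mulr_ge0 ?(ltW (g0 x)) ?(ltW (kap_gt0 x y))//.
by rewrite ler_piMl ?(ltW (g0 x))// kap_le1.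
Qed.

Lemma T_muE (g : X -> R) y : igr mu (fun x => kap x y * g x) ->
  T g y = (\int[mu]_x (kap x y * g x))^-1.
Proof.
move=> ig; rewrite /T_mu; case: eqP => // Iy.
have := integrable_fin_num measurableT ig.
by rewrite Iy.
Qed.

(** Since [k] lies between [1 / (E x * E y)] and [1], the reciprocals of the two integrals bound
    [T g] from below and, up to [E], from above. Comparing them is what makes [T g] tempered. *)
Definition balanced (m : probability X R) (g : X -> R) : Prop :=
  [/\ forall x, 0 < g x, igr m g &
      \int[m]_x g x <= Q * \int[m]_x ((E x)^-1 * g x)].

Definition admissible (m : probability X R) (g : X -> R) : Prop :=
  tempered E Q g /\ balanced m g.

Lemma T_mu_ge (g : X -> R) y : (forall x, 0 < g x) -> igr mu g ->
  (\int[mu]_x g x)^-1 <= T g y.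
Proof.
move=> g0 ig; rewrite T_muE; last exact: kernel_mass_integrable.
have ik := kernel_mass_integrable y g0 ig.
have k0 : 0 < \int[mu]_x (kap x y * g x).
  by apply: Rint_gt0 => // x; rewrite mulr_gt0// kap_gt0.
rewrite lef_pV2 ?posrE//; last exact: Rint_gt0.
by apply: Rint_le => // x; rewrite ler_piMl ?kap_le1// ltW.
Qed.

Lemma T_mu_le (g : X -> R) y : (forall x, 0 < g x) -> igr mu g ->
  T g y <= E y * (\int[mu]_x ((E x)^-1 * g x))^-1.
Proof.
move=> g0 ig; rewrite T_muE; last exact: kernel_mass_integrable.
have ik := kernel_mass_integrable y g0 ig.
have iw := weighted_integrable g0 ig.
have k0 : 0 < \int[mu]_x (kap x y * g x).
  by apply: Rint_gt0 => // x; rewrite mulr_gt0// kap_gt0.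
have w0 : 0 < \int[mu]_x ((E x)^-1 * g x).
  by apply: Rint_gt0 => // x; rewrite mulr_gt0// invr_gt0.
rewrite -[X in X * _]invrK -invfM lef_pV2 ?posrE ?mulr_gt0 ?invr_gt0//.
rewrite -RintZ//; apply: Rint_le => //; first exact: igrZ.
move=> x; rewrite mulrA -invfM ler_wpM2r ?(ltW (g0 x))// mulrC.
exact: cE.
Qed.

Lemma T_mu_measurable (g : X -> R) : (forall x, 0 < g x) -> igr mu g ->
  measurable_fun setT (T g).
Proof.
move=> g0 ig.
have -> : T g = (fun y => (\int[mu]_x (kap x y * g x))^-1).
  by apply/funext => y; rewrite T_muE//; exact: kernel_mass_integrable.
apply: measurable_recip; last first.
  move=> y; apply: Rint_gt0 => [x|]; last exact: kernel_mass_integrable.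
  by rewrite mulr_gt0// kap_gt0.
apply/measurable_EFinP.
rewrite (_ : EFin \o _ =
    fubini_G mu (fun z : X * X => (expR (- c z / eps) * g z.1)%:E)); last first.
  apply/funext => y; rewrite /= fineK//.
  exact: (integrable_fin_num measurableT (kernel_mass_integrable y g0 ig)).
apply: measurable_fun_fubini_tonelli_G.
  apply/measurable_EFinP; apply: measurable_funM; first exact: measurable_gibbs_kernel.
  exact: measurableT_comp (igr_meas ig) measurable_fst.
by move=> z; rewrite lee_fin mulr_ge0 ?expR_ge0// ltW.
Qed.

Lemma T_mu_gt0 (g : X -> R) y : (forall x, 0 < g x) -> igr mu g -> 0 < T g y.
Proof.
move=> g0 ig; apply: lt_le_trans (T_mu_ge y g0 ig).
by rewrite invr_gt0; exact: Rint_gt0.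
Qed.

(* Pointwise [w <= r * (w / E) + (w * E) / r]; with [r = 2 J^2] the second term is
   absorbed in half the bound for [g]. *)
Lemma T_mu_admissible (g : X -> R) : 4 * J ^+ 2 <= Q -> balanced mu g ->
  admissible nu (T g).
Proof.
move=> JQ [g0 ig gQ].
have Tge := (fun y => T_mu_ge y g0 ig); have Tle := (fun y => T_mu_le y g0 ig).
have T0 := (fun y => T_mu_gt0 y g0 ig); have mT := T_mu_measurable g0 ig.
have iw := weighted_integrable g0 ig.
set G := \int[mu]_x g x in gQ Tge; have G0 : 0 < G by exact: Rint_gt0.
set W := \int[mu]_x ((E x)^-1 * g x) in gQ Tle.
have W0 : 0 < W by apply: Rint_gt0 => // x; rewrite mulr_gt0// invr_gt0.
have WG : W^-1 <= Q * G^-1.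
  by rewrite ler_pdivlMr// ler_pdivrMl// mulrC.
have tT : tempered E Q (T g).
  split=> //; exists G^-1; first by rewrite invr_gt0.
  move=> y; rewrite Tge/= (le_trans (Tle y))// mulrA (mulrC (E y)).
  by rewrite ler_wpM2r ?(ltW (E0 y))// mulrC.
have iT : igr nu (T g).
  apply: (@tame_integrable _ _ _ _ _ inu _ W^-1) => // y.
  rewrite ger0_norm ?(ltW (T0 y))// (le_trans (Tle y))// mulrC.
  rewrite ler_wpM2l ?invr_ge0 ?(ltW W0)//.
  exact: (@weight_pow_le _ _ _ E E1 y 1).
split=> //; split=> //.
have iD := weighted_integrable T0 iT.
have iE2 : igr nu (fun x => E x ^+ 2) by exact: weight_integrable.
set D := \int[nu]_x ((E x)^-1 * T g x).
pose r := 2 * J ^+ 2.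
have r0 : 0 < r by rewrite mulr_gt0// exprn_gt0.
have HI : \int[nu]_x T g x <=
    \int[nu]_x (r * ((E x)^-1 * T g x) + r^-1 * W^-1 * E x ^+ 2).
  apply: Rint_le => //; first by apply: igrD; exact: igrZ.
  move=> y; have Ey := E0 y.
  have H : 1 <= r * (E y)^-1 + r^-1 * E y.
    rewrite -subr_ge0 (_ : _ - _ = 1 + (E y - r) ^+ 2 / (r * E y)); last first.
      by field; rewrite !gt_eqF.
    by rewrite addr_ge0// divr_ge0 ?sqr_ge0// mulr_ge0// ltW.
  have : T g y * 1 <= T g y * (r * (E y)^-1 + r^-1 * E y).
    by rewrite ler_wpM2l// ltW.
  have : r^-1 * E y * T g y <= r^-1 * E y * (E y * W^-1).
    by rewrite ler_wpM2l// mulr_ge0 ?invr_ge0// ltW.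
  lra.
have E2J : \int[nu]_x (E x ^+ 2) <= J by exact: (weight_pow_int mE E1 inu nuJ).
have HD : G^-1 * J^-1 <= D.
  apply: (@le_trans _ _ (\int[nu]_x (G^-1 * (E x)^-1))).
    rewrite RintZ; last exact: (weightV_integrable mE E1 inu).
    rewrite ler_wpM2l ?invr_ge0 ?(ltW G0)//.
    exact: (weightV_int_ge mE E1 inu nuJ).
  apply: Rint_le => //; first exact/igrZ/(weightV_integrable mE E1 inu).
  by move=> x; rewrite mulrC ler_wpM2l// invr_ge0 ltW.
have Q0 : 0 < Q by apply: lt_le_trans JQ; rewrite mulr_gt0// exprn_gt0.
have D0 : 0 < D by apply: lt_le_trans HD; rewrite mulr_gt0 ?invr_gt0.
have WD : W^-1 <= Q * J * D.
  apply: (le_trans WG).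
  have -> : Q * G^-1 = Q * J * (G^-1 * J^-1) by field; rewrite !gt_eqF.
  by rewrite ler_wpM2l// mulr_ge0// ltW.
apply: (le_trans HI).
rewrite RintD; [|exact: igrZ|exact: igrZ].
rewrite !RintZ// -/D.
have H1 : r^-1 * W^-1 * \int[nu]_x E x ^+ 2 <= r^-1 * (Q * J * D) * J.
  apply: ler_pM => //.
  - by rewrite mulr_ge0// invr_ge0 ltW.
  - by rewrite Rintegral_ge0// => x _; exact: sqr_ge0.
  - by rewrite ler_wpM2l// invr_ge0 ltW.
have H2 : r^-1 * (Q * J * D) * J = Q / 2 * D by rewrite /r; field; rewrite gt_eqF.
have H3 : r * D <= Q / 2 * D by rewrite ler_wpM2r ?(ltW D0)// /r; lra.
move: H1; rewrite H2; lra.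
Qed.

Lemma Q_ge1 : 4 * J ^+ 2 <= Q -> 1 <= Q.
Proof.
have : 1 <= J ^+ 2 by exact: exprn_ege1.
lra.
Qed.

(** Gibbs' inequality for [U = k u], [V = k v] and [h = ln u - ln v] compares the two masses; [T] is
    the reciprocal of the mass, which swaps [u] and [v] in the conclusion. *)
Lemma kernel_ratio (u v : X -> R) (m : R) y : balanced mu u -> balanced mu v ->
  igr mu (fun x => kap x y * u x * (ln (u x) - ln (v x))) ->
  \int[mu]_x (kap x y * u x * (ln (u x) - ln (v x))) <=
    m * \int[mu]_x (kap x y * u x) ->
  ln (T v y) - ln (T u y) <= m.
Proof.
move=> [u0 iu _] [v0 iv _] ih H.
have iku := kernel_mass_integrable y u0 iu.
have ikv := kernel_mass_integrable y v0 iv.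
have Zu : 0 < \int[mu]_x (kap x y * u x).
  by apply: Rint_gt0 => // x; rewrite mulr_gt0// kap_gt0.
have Zv : 0 < \int[mu]_x (kap x y * v x).
  by apply: Rint_gt0 => // x; rewrite mulr_gt0// kap_gt0.
have : \int[mu]_x (kap x y * u x) <= expR m * \int[mu]_x (kap x y * v x).
  apply: (gibbs (h := fun x => ln (u x) - ln (v x))) => // x.
  - by rewrite mulr_ge0 ?expR_ge0// ltW.
  - rewrite opprB expRD expRN !lnK ?posrE//.
    by field; rewrite gt_eqF.
rewrite !T_muE// !lnV ?posrE// => H1.
suff : ln (\int[mu]_x (kap x y * u x)) <= m + ln (\int[mu]_x (kap x y * v x)) by lra.
rewrite -ler_expR expRD !lnK ?posrE//.
Qed.

(** The first bound contracts but moves the centre by an unspecified amount; the second keeps the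
    centre [- lam] at the cost of the factor [1 + drift_cst]. The iteration runs on the first, and
    the second is used once, to link the two potentials of one iterate. *)
Lemma T_mu_contraction (u v : X -> R) (lam th : R) :
  4 * J ^+ 2 <= Q -> admissible mu u -> admissible mu v -> 0 <= th ->
  (forall x, `|ln (u x) - ln (v x) - lam| <= th * (1 + weight_cst J Q * E x ^+ 2)) ->
  (exists lam', forall y, `|ln (T u y) - ln (T v y) - lam'| <=
     contr_cst J Q * th * (1 + weight_cst J Q * E y ^+ 2)) /\
  (forall y, `|ln (T u y) - ln (T v y) + lam| <=
     th * (1 + drift_cst J Q) * (1 + weight_cst J Q * E y ^+ 2)).
Proof.
move=> JQ [tu bu] [tv bv] th0 uv.
have Q1 := Q_ge1 JQ.
have mu_ : measurable_fun setT u by case: tu.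
have mv : measurable_fun setT v by case: tv.
have mln w : measurable_fun setT w -> measurable_fun setT (fun x : X => ln (w x)).
  by move=> mw; apply: measurableT_comp mw; exact: measurable_ln.
have muv : measurable_fun setT (fun x => ln (u x) - ln (v x)).
  by apply: measurable_funB; exact: mln.
have mvu : measurable_fun setT (fun x => ln (v x) - ln (u x)).
  by apply: measurable_funB; exact: mln.
have vu x : `|ln (v x) - ln (u x) - (- lam)| <= th * (1 + weight_cst J Q * E x ^+ 2).
  by rewrite (_ : _ - _ = - (ln (u x) - ln (v x) - lam)) ?normrN//; ring.
have kE y x : (E x * E y)^-1 <= kap x y by exact: cE.
have key w z l : tempered E Q w -> balanced mu w -> balanced mu z ->
    measurable_fun setT (fun x => ln (w x) - ln (z x)) ->
    (forall x, `|ln (w x) - ln (z x) - l| <= th * (1 + weight_cst J Q * E x ^+ 2)) ->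
    forall y,
    ln (T z y) - ln (T w y) <= l + center_shift mu E J Q (fun x => ln (w x) - ln (z x)) l
      + contr_cst J Q * th * (1 + weight_cst J Q * E y ^+ 2) /\
    ln (T z y) - ln (T w y) <= l +
      th * (1 + weight_cst J Q * (E y ^+ 2 / 4 + drift_cst J Q)).
  move=> tw bw bz mwz wz y.
  have ikw : igr mu (fun x => kap x y * w x).
    by case: bw => w0 iw _; exact: kernel_mass_integrable.
  have ik0 := kernel_log_integrable mE E1 imu (measurable_kernel1 y)
    (fun x => kap_gt0 x y) (fun x => kap_le1 x y) tw mwz th0 wz.
  have ikl : igr mu (fun x => kap x y * w x * (ln (w x) - ln (z x))).
    rewrite (_ : (fun x => _) = fun x => kap x y * w x * (ln (w x) - ln (z x) - l) +
       l * (kap x y * w x)); last by apply/funext => x; ring.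
    by apply: igrD => //; exact: igrZ.
  split; apply: kernel_ratio => //.
    exact: (kernel_log_contraction mE E1 imu muJ Q1 (measurable_kernel1 y)
    (fun x => kap_gt0 x y) (fun x => kap_le1 x y) (E1 y) (kE y) tw mwz th0 wz).
  have := kernel_log_drift mE E1 imu muJ Q1 (measurable_kernel1 y)
    (fun x => kap_gt0 x y) (fun x => kap_le1 x y) (E1 y) (kE y) tw mwz th0 wz.
  rewrite mulrDl => H.
  rewrite (_ : (fun x => _) = fun x => kap x y * w x * (ln (w x) - ln (z x) - l) +
       l * (kap x y * w x)); last by apply/funext => x; ring.
  rewrite RintD//; last exact: igrZ.
  by rewrite RintZ// addrC lerD2l.
have Huv := key _ _ _ tu bu bv muv uv.
have Hvu := key _ _ _ tv bv bu mvu vu.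
(* The upper bound comes from tilting by [u], the lower one from tilting by [v]. The shift is odd
   under this exchange, so the two one-sided bounds share a centre. *)
have shN : center_shift mu E J Q (fun x => ln (v x) - ln (u x)) (- lam) =
    - center_shift mu E J Q (fun x => ln (u x) - ln (v x)) lam.
  rewrite /center_shift -mulrN; congr (_ * _).
  have iL := weightV_log_integrable mE E1 imu muJ Q1 muv th0 uv.
  rewrite -[RHS]mulN1r -RintZ//.
  by apply: eq_Rintegral => x _; ring.
have w0 : 0 < weight_cst J Q by exact: (weight_cst_gt0 mE E1 imu muJ Q1).
have w1 : weight_cst J Q <= 1 by exact: (weight_cst_le1 mE E1 imu muJ Q1).
have d1 : 1 <= drift_cst J Q by exact: (drift_cst_ge1 mE E1 imu muJ Q1).
split.
  exists (- (lam + center_shift mu E J Q (fun x => ln (u x) - ln (v x)) lam)) => y.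
  have [H1 _] := Huv y; have [H2 _] := Hvu y; rewrite shN in H2.
  by rewrite ler_norml; apply/andP; split; lra.
move=> y.
have [_ H1] := Huv y; have [_ H2] := Hvu y.
have H : th * (1 + weight_cst J Q * (E y ^+ 2 / 4 + drift_cst J Q)) <=
   th * (1 + drift_cst J Q) * (1 + weight_cst J Q * E y ^+ 2).
  rewrite -mulrA ler_wpM2l//.
  have e2 : 0 <= E y ^+ 2 by exact: sqr_ge0.
  have we : 0 <= weight_cst J Q * E y ^+ 2 by rewrite mulr_ge0// ltW.
  have : 0 <= drift_cst J Q * (weight_cst J Q * E y ^+ 2).
    by rewrite mulr_ge0// (le_trans _ d1).
  have : weight_cst J Q * drift_cst J Q <= 1 * drift_cst J Q.
    by rewrite ler_wpM2r// (le_trans _ d1).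
  lra.
by rewrite ler_norml; apply/andP; split; lra.
Qed.

End scaling_map.

Section log_distance.
Context {R : realType}.

Lemma dist_le_ln (a b : R) : 0 < a -> 0 < b -> `|a - b| <= `|ln a - ln b| * (a + b).
Proof.
wlog ab : a b / b <= a => [H a0 b0|a0 b0].
  have [ba|/ltW ab] := leP b a; first exact: H.
  by rewrite distrC (distrC (ln a)) (addrC a); exact: H.
have lab : ln b <= ln a by rewrite ler_ln ?posrE.
rewrite !ger0_norm ?subr_ge0//.
have : 1 + (ln b - ln a) <= b / a.
  by rewrite -[X in _ <= X]lnK ?posrE ?divr_gt0// ln_div ?posrE// expR_ge1Dx.
rewrite ler_pdivlMr// => H.
have : 0 <= (ln a - ln b) * b by rewrite mulr_ge0 ?subr_ge0// ltW.
lra.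
Qed.

End log_distance.

(** * Geometric rates for the potentials and the plan densities *)

Section sinkhorn_rate.
Context {R : realType} {d : measure_display} {X : measurableType d}.
Variables (mu nu : probability X R) (c : X * X -> R) (eps : R).
Variables (E : X -> R) (J Q : R).
Hypothesis eps0 : 0 < eps.
Hypothesis c0 : forall z, 0 <= c z.
Hypothesis mc : measurable_fun setT c.
Hypothesis mE : measurable_fun setT E.
Hypothesis E1 : forall x, 1 <= E x.
Hypothesis imu : mu.-integrable setT (EFin \o (fun x => E x ^+ 3)).
Hypothesis muJ : \int[mu]_x (E x ^+ 3) <= J.
Hypothesis inu : nu.-integrable setT (EFin \o (fun x => E x ^+ 3)).
Hypothesis nuJ : \int[nu]_x (E x ^+ 3) <= J.
Hypothesis cE : forall x y, (E x * E y)^-1 <= expR (- c (x, y) / eps).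
Hypothesis JQ : 4 * J ^+ 2 <= Q.
Local Notation Tm := (T_mu mu c eps).
Local Notation Tn := (T_nu nu c eps).
Local Notation kap x y := (expR (- c (x, y) / eps)).
Local Notation igr m f := (m.-integrable setT (EFin \o f)).
Local Notation be := (weight_cst J Q).
Local Notation ga := (contr_cst J Q).
Local Notation g1 n := (sinkhorn mu nu c eps n).1.
Local Notation g2 n := (sinkhorn mu nu c eps n).2.

Let E0 x : 0 < E x. Proof. exact: lt_le_trans ltr01 (E1 x). Qed.
Let J1 : 1 <= J. Proof. exact: (J_ge1 mE E1 imu muJ). Qed.
Let J0 : 0 < J. Proof. exact: lt_le_trans J1. Qed.
Let Q1 : 1 <= Q. Proof. exact: (Q_ge1 mE E1 imu muJ). Qed.
Let Q0 : 0 < Q. Proof. exact: lt_le_trans Q1. Qed.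
Let be0 : 0 < be. Proof. exact: (weight_cst_gt0 mE E1 imu muJ Q1). Qed.
Let be1 : be <= 1. Proof. exact: (weight_cst_le1 mE E1 imu muJ Q1). Qed.
Let dr1 : 1 <= drift_cst J Q. Proof. exact: (drift_cst_ge1 mE E1 imu muJ Q1). Qed.
Let ga01 : 0 < ga < 1. Proof. exact: (contr_cst_itv mE E1 imu muJ Q1). Qed.

(** [T_nu] for [c] is by conversion [T_mu] for the transposed cost, so each fact about [T_mu] serves
    both half-steps. *)
Let c' (z : X * X) := c (z.2, z.1).
Let c'0 z : 0 <= c' z. Proof. exact: c0. Qed.
Let mc' : measurable_fun setT c'.
Proof. exact: (measurableT_comp mc (@measurable_swap _ _ X X)). Qed.
Let c'E x y : (E x * E y)^-1 <= expR (- c' (x, y) / eps).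
Proof. by rewrite mulrC; exact: cE. Qed.

Lemma T_nuE (g : X -> R) : Tn g = T_mu nu c' eps g. Proof. by []. Qed.

Lemma Tm_admissible (g : X -> R) : balanced E Q mu g -> admissible E Q nu (Tm g).
Proof. by move=> ?; exact: (T_mu_admissible eps0 c0 mc mE E1 imu muJ). Qed.

Lemma Tn_admissible (g : X -> R) : balanced E Q nu g -> admissible E Q mu (Tn g).
Proof. by move=> ?; rewrite T_nuE; exact: (T_mu_admissible eps0 c'0 mc' mE E1 inu nuJ). Qed.

Lemma one_admissible (m : probability X R) :
  igr m (fun x => E x ^+ 3) -> \int[m]_x (E x ^+ 3) <= J ->
  admissible E Q m (fun=> 1).
Proof.
move=> im mJ.
have i1 : igr m (fun=> 1).
  by apply: (tame_integrable im (C := 1)) => // x; rewrite normr1 mul1r exprn_ege1.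
split; last first.
  split=> //; rewrite Rint_cst.
  under eq_Rintegral do rewrite mulr1.
  apply: (@le_trans _ _ (Q * J^-1)).
    rewrite ler_pdivlMr// mul1r; apply: le_trans JQ.
    have : J * 1 <= J * J by rewrite ler_wpM2l// ltW.
    by have := J1; rewrite expr2; lra.
  by rewrite ler_wpM2l ?(ltW Q0)//; exact: (weightV_int_ge mE E1 im mJ).
split; first exact: measurable_cst.
by exists 1 => // x; rewrite lexx mul1r mulr_ege1.
Qed.

Lemma sinkhorn_admissible n : admissible E Q mu (g1 n) /\ admissible E Q nu (g2 n).
Proof.
elim: n => [|n [IH1 IH2]]; first by split; exact: one_admissible.
have H : admissible E Q mu (g1 n.+1) by apply: Tn_admissible; case: IH2.
by split=> //; apply: Tm_admissible; case: H.
Qed.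

Variables h1 h2 : X -> R.
Hypothesis h1E : h1 = Tn h2.
Hypothesis h2E : h2 = Tm h1.
Hypothesis ah1 : admissible E Q mu h1.
Hypothesis ah2 : admissible E Q nu h2.

(** Start of the iteration: after centring at [ln a - ln b], the log-ratio is at most
    [ln (Q * E) <= Q * E <= Q * E^2]. The radius is [Q / be] because [E^2] carries the coefficient
    [be] in the weight. *)
Lemma tempered_ln (u v : X -> R) : tempered E Q u -> tempered E Q v ->
  exists lam, forall x,
    `|ln (u x) - ln (v x) - lam| <= Q / be * (1 + be * E x ^+ 2).
Proof.
move=> [_ [a a0 au]] [_ [b b0 bv]]; exists (ln a - ln b) => x.
have QE : 1 <= Q * E x by rewrite mulr_ege1.
have aux w e : 0 < e -> e <= w <= e * (Q * E x) -> ln e <= ln w <= ln e + Q * E x.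
  move=> e0 /andP[ew we]; have w0 : 0 < w by apply: lt_le_trans ew.
  have qe0 : 0 < Q * E x by exact: lt_le_trans QE.
  rewrite ler_ln ?posrE// ew/=.
  apply: (@le_trans _ _ (ln (e * (Q * E x)))); first by rewrite ler_ln ?posrE// mulr_gt0.
  by rewrite lnM ?posrE// lerD2l ltW// ln_sublinear.
have /andP[H1 H2] := aux _ _ a0 (au x).
have /andP[H3 H4] := aux _ _ b0 (bv x).
have H : Q * E x <= Q / be * (1 + be * E x ^+ 2).
  have -> : Q / be * (1 + be * E x ^+ 2) = Q / be + Q * E x ^+ 2.
    by field; rewrite gt_eqF.
  have EE : Q * E x <= Q * E x ^+ 2.
    by rewrite ler_wpM2l ?(ltW Q0)// expr2 ler_peMl// ltW.
  by apply: (le_trans EE); rewrite lerDr divr_ge0// ltW.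
by rewrite ler_norml; apply/andP; split; lra.
Qed.

Lemma sinkhorn_log_rate n :
  (exists lam, forall x, `|ln (g1 n x) - ln (h1 x) - lam| <=
    Q / be * ga ^+ n * (1 + be * E x ^+ 2)) /\
  (exists lam, forall x, `|ln (g2 n x) - ln (h2 x) - lam| <=
    Q / be * ga ^+ n * (1 + be * E x ^+ 2)).
Proof.
have [ga0 ga1] := andP ga01.
have Th0 n' : 0 <= Q / be * ga ^+ n'.
  by rewrite mulr_ge0 ?exprn_ge0 ?(ltW ga0)// divr_ge0// ltW.
elim: n => [|n [_ [lam IH]]].
  have [[? _] [? _]] := sinkhorn_admissible 0.
  have [? _] := ah1; have [? _] := ah2.
  by rewrite expr0 mulr1; split; exact: tempered_ln.
have [_ A2] := sinkhorn_admissible n; have [A1 _] := sinkhorn_admissible n.+1.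
have [[lam1 H1] _] :=
  T_mu_contraction eps0 c'0 mc' mE E1 inu nuJ c'E JQ A2 ah2 (Th0 n) IH.
rewrite -!T_nuE -h1E in H1.
have H1' x : `|ln (g1 n.+1 x) - ln (h1 x) - lam1| <=
    Q / be * ga ^+ n.+1 * (1 + be * E x ^+ 2).
  rewrite (_ : Q / be * ga ^+ n.+1 = ga * (Q / be * ga ^+ n)); first exact: H1.
  by rewrite exprS; ring.
split; first by exists lam1.
have [[lam2 H2] _] :=
  T_mu_contraction eps0 c0 mc mE E1 imu muJ cE JQ A1 ah1 (Th0 n.+1) H1'.
rewrite -h2E in H2.
(* The second half-step gains a further factor [ga], which is given up so that both potentials have
   the same bound. *)
exists lam2 => x; apply: (le_trans (H2 x)).
apply: ler_wpM2r; first by rewrite addr_ge0// mulr_ge0 ?sqr_ge0// ltW.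
by rewrite ler_piMl// ltW.
Qed.

(* The two centering constants are opposite, so they cancel in the product
   [g1 x * g2 y]. *)
Lemma sinkhorn_joint_rate n : exists lam,
  (forall x, `|ln (g1 n.+1 x) - ln (h1 x) - lam| <=
    Q / be * ga ^+ n.+1 * (1 + be * E x ^+ 2)) /\
  (forall x, `|ln (g2 n.+1 x) - ln (h2 x) + lam| <=
    Q / be * ga ^+ n.+1 * (1 + drift_cst J Q) * (1 + be * E x ^+ 2)).
Proof.
have [ga0 ga1] := andP ga01.
have Th0 : 0 <= Q / be * ga ^+ n.+1.
  by rewrite mulr_ge0 ?exprn_ge0 ?(ltW ga0)// divr_ge0// ltW.
have [[lam H] _] := sinkhorn_log_rate n.+1; exists lam; split=> //.
have [A1 _] := sinkhorn_admissible n.+1.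
have [_] := T_mu_contraction eps0 c0 mc mE E1 imu muJ cE JQ A1 ah1 Th0 H.
by rewrite -h2E.
Qed.

(** The unknown scale cancels: [u <= a Q E], while [T u <= E J / a] because [u >= a]. *)
Lemma potential_product_le (u : X -> R) x y : admissible E Q mu u ->
  u x * Tm u y <= Q * J * (E x * E y).
Proof.
move=> [[mu_ [a a0 au]] [u0 iu _]].
have W : a / J <= \int[mu]_x ((E x)^-1 * u x).
  apply: (@le_trans _ _ (\int[mu]_x (a * (E x)^-1))).
    rewrite RintZ; last exact: (weightV_integrable mE E1 imu).
    by rewrite ler_wpM2l ?(ltW a0)//; exact: (weightV_int_ge mE E1 imu muJ).
  apply: Rint_le; [exact/igrZ/(weightV_integrable mE E1 imu)|exact: weighted_integrable|].
  move=> z; rewrite mulrC ler_wpM2l ?invr_ge0 ?(ltW (E0 z))//.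
  by have /andP[] := au z.
have aJ0 : 0 < a / J by rewrite divr_gt0.
have W0 : 0 < \int[mu]_x ((E x)^-1 * u x) by exact: lt_le_trans W.
apply: (@le_trans _ _ (a * (Q * E x) * (E y * (a / J)^-1))).
  apply: ler_pM.
  - exact: ltW.
  - exact/ltW/(T_mu_gt0 eps0 c0 mc).
  - by have /andP[] := au x.
  apply: (le_trans (T_mu_le eps0 c0 mc mE E1 cE y u0 iu)).
  by rewrite ler_wpM2l ?(ltW (E0 y))// lef_pV2 ?posrE.
by rewrite le_eqVlt; apply/orP; left; apply/eqP; field; rewrite !gt_eqF.
Qed.

Lemma weight_product_integral :
  (\int[mu \x nu]_z ((E z.1 ^+ 3 * E z.2 ^+ 3)%:E) <= (J ^+ 2)%:E)%E.
Proof.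
have E30 x : 0 <= E x ^+ 3 by rewrite exprn_ge0// ltW.
have mE3 : measurable_fun setT (fun x => E x ^+ 3) by exact: measurable_funX.
rewrite fubini_tonelli1/=; last 2 first.
- apply/measurable_EFinP; apply: measurable_funM.
    exact: measurableT_comp mE3 measurable_fst.
  exact: measurableT_comp mE3 measurable_snd.
- by move=> z; rewrite lee_fin mulr_ge0.
rewrite /fubini_F/=.
have -> : (\int[mu]_x \int[nu]_y (E x ^+ 3 * E y ^+ 3)%:E)%E =
    (\int[mu]_x ((E x ^+ 3) * \int[nu]_y (E y ^+ 3))%:E)%E.
  apply: eq_integral => x _.
  rewrite -RintZ// fineK//.
  exact: (integrable_fin_num measurableT (igrZ (E x ^+ 3) inu)).
have i2 : igr mu (fun x => E x ^+ 3 * \int[nu]_y (E y ^+ 3)).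
  by have := igrZ (\int[nu]_y (E y ^+ 3)) imu; under eq_fun do rewrite mulrC.
have /fineK <- := integrable_fin_num measurableT i2.
rewrite lee_fin (_ : fine _ = \int[mu]_x (E x ^+ 3 * \int[nu]_y (E y ^+ 3)))//.
under eq_Rintegral do rewrite mulrC.
rewrite RintZ// expr2; apply: ler_pM => //; rewrite Rintegral_ge0//.
Qed.

(** The log-ratio of the products contributes [E^2] in each variable and the size of the products
    one more [E], so the third moments suffice. The constant is [8 = 4 * 2]: [2 + s + t <= 4 s t]
    for [s, t >= 1], and two products are added. *)
Lemma density_rate n x y :
  `|plan_density c eps (g1 n) (g2 n) (x, y) - plan_density c eps h1 h2 (x, y)| <=
  (8 * (Q / be) * (1 + drift_cst J Q) * Q * J) * ga ^+ n * (E x ^+ 3 * E y ^+ 3).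
Proof.
have [ga0 ga1] := andP ga01.
set th := Q / be; have th1 : 1 <= th.
  by rewrite /th ler_pdivlMr// mul1r (le_trans be1).
have th0 : 0 < th by exact: lt_le_trans th1.
set K := drift_cst J Q; have K1 : 1 <= K := dr1.
have K0 : 0 <= K by exact: le_trans K1.
have [[_ [u0 _ _]] [_ [v0 _ _]]] := sinkhorn_admissible n.
have [_ [h10 _ _]] := ah1; have [_ [h20 _ _]] := ah2.
have Ex := E1 x; have Ey := E1 y.
have EE : 0 < E x * E y by rewrite mulr_gt0.
have QJ : 1 <= Q * J by rewrite mulr_ege1.
have E3 : E x ^+ 3 * E y ^+ 3 = E x ^+ 2 * E y ^+ 2 * (E x * E y) by ring.
have Ex2 : 1 <= E x ^+ 2 by exact: exprn_ege1.
have Ey2 : 1 <= E y ^+ 2 by exact: exprn_ege1.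
have ph : h1 x * h2 y <= Q * J * (E x * E y).
  by rewrite [in X in _ * X]h2E; exact: potential_product_le.
have pg : g1 n x * g2 n y <= Q * J * (E x * E y).
  case: n {u0 v0} => [|n]; last first.
    by apply: potential_product_le; have [] := sinkhorn_admissible n.+1.
  by rewrite /= mulr1 !mulr_ege1.
have -> : plan_density c eps (g1 n) (g2 n) (x, y) - plan_density c eps h1 h2 (x, y)
    = kap x y * (g1 n x * g2 n y - h1 x * h2 y) by rewrite /plan_density/=; ring.
rewrite normrM (ger0_norm (expR_ge0 _)).
set D := `|_ - _|.
apply: (@le_trans _ _ (1 * D)); first by apply: ler_wpM2r; [exact: normr_ge0|exact: kap_le1].
rewrite mul1r.
have g0 : 0 < g1 n x * g2 n y by rewrite mulr_gt0.
have h0 : 0 < h1 x * h2 y by rewrite mulr_gt0.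
have S0 : g1 n x * g2 n y + h1 x * h2 y <= 2 * (Q * J * (E x * E y)) by lra.
(* At [n = 0] the second potential is not the image of the first, so their centres are unrelated;
   the difference is then bounded by the sum of the two products. *)
have [n0|[m nm]] : n = 0 \/ exists m, n = m.+1.
    by case: (n) => [|m]; [left|right; exists m].
  rewrite {1}n0 expr0.
  apply: (@le_trans _ _ (g1 n x * g2 n y + h1 x * h2 y)).
    by rewrite /D (le_trans (ler_normB _ _))// !gtr0_norm.
  apply: (le_trans S0).
  rewrite E3.
  have F1 : 1 <= th * (1 + K) * (E x ^+ 2 * E y ^+ 2).
    apply: mulr_ege1; last exact: mulr_ege1.
    by apply: mulr_ege1 => //; rewrite lerDl.
  have : Q * J * (E x * E y) * 1 <=
      Q * J * (E x * E y) * (th * (1 + K) * (E x ^+ 2 * E y ^+ 2)).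
    by rewrite ler_wpM2l// mulr_ge0 ?(ltW EE)// (le_trans _ QJ).
  lra.
have [lam [H1 H2]] := sinkhorn_joint_rate m; rewrite -nm in H1 H2.
have := H1 x; have := H2 y; rewrite -/th => {H2} {}H2 {}H1.
apply: (le_trans (dist_le_ln g0 h0)).
have thn : 0 <= th * ga ^+ n by rewrite mulr_ge0 ?exprn_ge0// ltW.
have L : `|ln (g1 n x * g2 n y) - ln (h1 x * h2 y)| <=
    th * ga ^+ n * (1 + K) * (4 * (E x ^+ 2 * E y ^+ 2)).
  rewrite !lnM ?posrE//.
  have bx : be * E x ^+ 2 <= E x ^+ 2 by rewrite ler_piMl// sqr_ge0.
  have by_ : be * E y ^+ 2 <= E y ^+ 2 by rewrite ler_piMl// sqr_ge0.
  have H1' : `|ln (g1 n x) - ln (h1 x) - lam| <= th * ga ^+ n * (1 + K) * (1 + E x ^+ 2).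
    apply: (le_trans H1); apply: ler_pM => //.
    - by rewrite addr_ge0// mulr_ge0 ?sqr_ge0// ltW.
    - by rewrite ler_peMr// lerDl.
    - by rewrite lerD2l.
  have H2' : `|ln (g2 n y) - ln (h2 y) + lam| <= th * ga ^+ n * (1 + K) * (1 + E y ^+ 2).
    apply: (le_trans H2); apply: ler_wpM2l; last by rewrite lerD2l.
    by rewrite mulr_ge0// addr_ge0.
  have -> : ln (g1 n x) + ln (g2 n y) - (ln (h1 x) + ln (h2 y)) =
    (ln (g1 n x) - ln (h1 x) - lam) + (ln (g2 n y) - ln (h2 y) + lam) by ring.
  apply: (le_trans (ler_normD _ _)); apply: (le_trans (lerD H1' H2')).
  rewrite -mulrDr ler_wpM2l//; first by rewrite mulr_ge0// addr_ge0.
  by nra.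
apply: (@le_trans _ _ (th * ga ^+ n * (1 + K) * (4 * (E x ^+ 2 * E y ^+ 2)) *
   (2 * (Q * J * (E x * E y))))).
  by apply: ler_pM => //; rewrite addr_ge0// ltW.
by rewrite E3 le_eqVlt; apply/orP; left; apply/eqP; ring.
Qed.

Lemma sinkhorn_L1_rate : exists2 A, 0 < A & forall n,
  (\int[mu \x nu]_z (`| plan_density c eps (g1 n) (g2 n) z
              - plan_density c eps h1 h2 z |)%:E <= (A * ga ^+ n)%:E)%E.
Proof.
have [ga0 ga1] := andP ga01.
have th0 : 0 < Q / be by rewrite divr_gt0.
have K0 : 0 < 1 + drift_cst J Q by have := dr1; lra.
set C := 8 * (Q / be) * (1 + drift_cst J Q) * Q * J.
have C0 : 0 < C.
  apply: mulr_gt0 J0; apply: mulr_gt0 Q0; apply: mulr_gt0 K0.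
  by apply: mulr_gt0 th0.
exists (C * J ^+ 2) => [|n]; first by rewrite mulr_gt0 ?exprn_gt0.
have Cn0 : 0 <= C * ga ^+ n by rewrite mulr_ge0 ?exprn_ge0// ltW.
have [[[m1 _] _] [[m2 _] _]] := sinkhorn_admissible n.
have [[mh1 _] _] := ah1; have [[mh2 _] _] := ah2.
have mE3 : measurable_fun setT (fun x => E x ^+ 3) by exact: measurable_funX.
have mEE : measurable_fun setT (fun z : X * X => E z.1 ^+ 3 * E z.2 ^+ 3).
  apply: measurable_funM.
    exact: measurableT_comp mE3 measurable_fst.
  exact: measurableT_comp mE3 measurable_snd.
apply: (@le_trans _ _ (\int[mu \x nu]_z
    ((C * ga ^+ n)%:E * (E z.1 ^+ 3 * E z.2 ^+ 3)%:E))%E).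
  apply: ge0_le_integral => //.
  - apply/measurable_EFinP; apply: measurableT_comp => //.
    by apply: measurable_funB; exact: measurable_plan_density.
  - by apply/measurable_EFinP; apply: measurable_funM.
  - by move=> [x y] _; rewrite -EFinM lee_fin; exact: density_rate.
rewrite ge0_integralZl//; last 2 first.
- exact/measurable_EFinP.
- by move=> z _; rewrite lee_fin mulr_ge0// exprn_ge0// ltW.
rewrite [(C * J ^+ 2 * _)](_ : _ = C * ga ^+ n * J ^+ 2); last by ring.
by rewrite [leRHS]EFinM; apply: lee_wpmul2l weight_product_integral; rewrite lee_fin.
Qed.

End sinkhorn_rate.

(** * Hilbert's metric *)

Section hilbert.
Context {R : realType} {d : measure_display} {X : measurableType d}.
Variable mu : probability X R.
Local Notation igr f := (mu.-integrable setT (EFin \o f)).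

(* The junk values of [inf], [sup] and [ln] only make the left-hand side smaller. *)
Lemma hilbert_dist_le (C : set (X -> R)) (f g : X -> R) (a b b' t : R) :
  0 < a -> 0 < b -> 0 < b' -> C (fun x => b * g x - f x) ->
  C (fun x => f x - a * g x) -> C (fun x => b' * f x - g x) ->
  ~ {ae mu, forall x, g x = 0} -> 0 <= t -> b / a <= expR t ->
  (hilbert_dist mu C f g <= t%:E)%E.
Proof.
move=> a0 b0 b'0 Cb Ca Cb' g0 t0 bat.
rewrite /hilbert_dist asboolT; last first.
  by split=> //; split; [exists b|exists b'].
rewrite lee_fin.
have Mb : hM C f g <= b.
  by apply: ge_inf => //; exists 0 => x [] /ltW.
have M0 : 0 <= hM C f g.
  by apply: lb_le_inf; [exists b|move=> x [] /ltW].
have [Mm|Mm] := ltP 0 (hM C f g / hm C f g); last by rewrite ln0.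
have m0 : 0 < hm C f g.
  rewrite lt_neqAle; apply/andP; split.
    by apply/eqP => m0; move: Mm; rewrite -m0 invr0 mulr0 ltxx.
  rewrite -invr_ge0 leNgt; apply/negP => m0.
  by move: Mm; rewrite ltNge => /negP; apply; rewrite mulr_ge0_le0// ltW.
have am : a <= hm C f g.
  apply: ub_le_sup; last by split.
  apply: contrapT => ub; move: m0; rewrite /hm sup_out ?ltxx// => -[_ ?].
  exact: ub.
rewrite -ler_expR lnK ?posrE//; apply: le_trans bat.
by apply: ler_pM => //; rewrite ?invr_ge0 ?(ltW m0)// lef_pV2 ?posrE.
Qed.

Variables (B : R -> set X) (m1 m2 : R) (alpha alphat : R -> R).
Local Notation F := (coneF mu B m1 m2 alpha alphat).
Local Notation G := (coneG mu B m1 m2 alpha alphat).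
Variables (E : X -> R) (Q CF : R).
Hypothesis E1 : forall x, 1 <= E x.
Hypothesis imu : igr (fun x => E x ^+ 3).
Hypothesis Q0 : 0 < Q.
Hypothesis CF0 : 0 <= CF.
(** Apart from measurability, this is all that is used about the cone. The positive part replaces
    [f], with which it agrees almost everywhere, so that [f mu] is a measure with a pointwise
    nonnegative density. *)
Hypothesis FE : forall f, F f -> {ae mu, forall x, 0 <= f x} /\
  igr (fun x => Num.max (f x) 0 * E x ^+ 3) /\
  \int[mu]_x (Num.max (f x) 0 * E x ^+ 3) <= CF * \int[mu]_x (Num.max (f x) 0).

Let E0 x : 0 < E x. Proof. exact: lt_le_trans ltr01 (E1 x). Qed.

Lemma coneF_measurable f : F f -> measurable_fun setT (fun x => Num.max (f x) 0).
Proof. by move=> [[mf _] _ _ _]; apply: measurable_maxr. Qed.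

Lemma coneF_integrable f (z : X -> R) C n : F f -> measurable_fun setT z ->
  (forall x, `|z x| <= C * E x ^+ n) -> (n <= 3)%N ->
  igr (fun x => Num.max (f x) 0 * z x).
Proof.
move=> Ff mz zC n3; have [_ [iF _]] := FE Ff.
apply: (igr_le _ (igrZ `|C| iF)) => [|x].
  by apply: measurable_funM => //; exact: coneF_measurable.
have f0 : 0 <= Num.max (f x) 0 by rewrite le_max lexx orbT.
rewrite normrM (ger0_norm f0) mulrCA ler_wpM2l//.
apply: (le_trans (zC x)); apply: (@le_trans _ _ (`|C| * E x ^+ n)).
  by rewrite ler_wpM2r ?ler_norm// exprn_ge0// ltW.
by rewrite ler_wpM2l//; exact: weight_pow_le.
Qed.

(** [w] is built from a given potential, whose bounds are known only almost everywhere; [z] is its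
    version with bounds everywhere. Square integrability comes from the moment of [E]. *)
Lemma coneG_intro (w z : X -> R) C : measurable_fun setT w ->
  measurable_fun setT z -> {ae mu, forall x, w x = z x} ->
  (forall x, `|z x| <= C * E x) ->
  (forall f, F f -> 0 <= \int[mu]_x (Num.max (f x) 0 * z x)) -> G w.
Proof.
move=> mw mz wz zC zF; split.
  split=> //.
  have -> : (\int[mu]_x (w x ^+ 2)%:E = \int[mu]_x (z x ^+ 2)%:E)%E.
    apply: ae_eq_integral => //.
    - by apply/measurable_EFinP; exact: measurable_funX.
    - by apply/measurable_EFinP; exact: measurable_funX.
    - by apply: filterS wz => x + _ => ->.
  have iz : igr (fun x => z x ^+ 2).
    apply: (tame_integrable imu (C := C ^+ 2)) => [|x]; first exact: measurable_funX.
    rewrite normrX; apply: (@le_trans _ _ (C ^+ 2 * E x ^+ 2)).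
      by rewrite -exprMn lerXn2r ?nnegrE// (le_trans _ (zC x)).
    by rewrite ler_wpM2l ?sqr_ge0//; exact: weight_pow_le.
  exact: integrable_lty iz.
move=> f Ff; have [f0 _] := FE Ff.
have mf : measurable_fun setT f by case: Ff => -[].
have mf' := coneF_measurable Ff.
have -> : (\int[mu]_x (f x * w x)%:E =
    \int[mu]_x (Num.max (f x) 0 * z x)%:E)%E.
  apply: ae_eq_integral => //.
  - by apply/measurable_EFinP; exact: measurable_funM.
  - by apply/measurable_EFinP; exact: measurable_funM.
  - by apply: filterS2 wz f0 => x -> /max_idPl ->.
have iz : igr (fun x => Num.max (f x) 0 * z x).
  by apply: (@coneF_integrable _ _ C 1) => //.
have /fineK <- := integrable_fin_num measurableT iz.
by rewrite lee_fin; exact: zF.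
Qed.

(** In Gibbs' inequality for the density [f u], the exponent is controlled by
    [u * (1 + be * E^2) <= 2 a Q E^3], then by the moment bound for [f]. The lower bound [u >= a]
    finally turns [a * int f] into [int f u], which removes the scale. *)
Lemma coneF_ratio (u v : X -> R) lam th be f : F f ->
  tempered E Q u -> tempered E Q v -> 0 <= th -> 0 < be <= 1 ->
  (forall x, `|ln (u x) - ln (v x) - lam| <= th * (1 + be * E x ^+ 2)) ->
  \int[mu]_x (Num.max (f x) 0 * u x) <=
  expR (lam + 2 * th * Q * CF) * \int[mu]_x (Num.max (f x) 0 * v x).
Proof.
move=> Ff [mu_ [a a0 au]] [mv [b b0 bv]] th0 /andP[be0 be1] uv.
have [_ [iF HF]] := FE Ff.
have f0 x : 0 <= Num.max (f x) 0 by rewrite le_max lexx orbT.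
have u0 x : 0 < u x by have /andP[/(lt_le_trans a0)] := au x.
have v0 x : 0 < v x by have /andP[/(lt_le_trans b0)] := bv x.
have mf := coneF_measurable Ff.
have mln w : measurable_fun setT w -> measurable_fun setT (fun x : X => ln (w x)).
  by move=> mw; apply: measurableT_comp mw; exact: measurable_ln.
have i1 : igr (fun x => Num.max (f x) 0).
  rewrite (_ : (fun x => _) = (fun x => Num.max (f x) 0 * 1)); last first.
    by apply/funext => x; rewrite mulr1.
  apply: (@coneF_integrable f (fun=> 1) 1 0 Ff) => // x.
  by rewrite normr1 mul1r.
have iu : igr (fun x => Num.max (f x) 0 * u x).
  apply: (@coneF_integrable _ _ (a * Q) 1) => // x.
  by rewrite gtr0_norm// -mulrA; have /andP[] := au x.
have iv : igr (fun x => Num.max (f x) 0 * v x).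
  apply: (@coneF_integrable _ _ (b * Q) 1) => // x.
  by rewrite gtr0_norm// -mulrA; have /andP[] := bv x.
have ubd x : `|u x * (ln (u x) - ln (v x) - lam)| <= a * Q * (2 * th) * E x ^+ 3.
  rewrite normrM gtr0_norm//.
  have -> : a * Q * (2 * th) * E x ^+ 3 = a * (Q * E x) * (th * (E x ^+ 2 + E x ^+ 2)).
    by ring.
  apply: ler_pM => //; [exact: ltW|by have /andP[] := au x|].
  apply: (le_trans (uv x)); rewrite ler_wpM2l// lerD ?exprn_ege1//.
  by rewrite ler_piMl ?sqr_ge0.
have ih : igr (fun x => Num.max (f x) 0 * (u x * (ln (u x) - ln (v x) - lam))).
  apply: (@coneF_integrable _ _ (a * Q * (2 * th)) 3) => //.
  apply: measurable_funM => //; apply: measurable_funB => //.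
  by apply: measurable_funB; exact: mln.
have hE : (fun x => Num.max (f x) 0 * u x * (ln (u x) - ln (v x))) =
    (fun x => Num.max (f x) 0 * (u x * (ln (u x) - ln (v x) - lam)) +
              lam * (Num.max (f x) 0 * u x)).
  by apply/funext => x; ring.
apply: (gibbs (h := fun x => ln (u x) - ln (v x))) => //.
- by move=> x; rewrite mulr_ge0// ltW.
- move=> x; rewrite opprB expRD expRN !lnK ?posrE//.
  by field; rewrite gt_eqF.
- by rewrite hE; apply: igrD => //; exact: igrZ.
rewrite hE RintD//; last exact: igrZ.
rewrite RintZ// mulrDl addrC lerD2l.
apply: (@le_trans _ _ (a * Q * (2 * th) * \int[mu]_x (Num.max (f x) 0 * E x ^+ 3))).
  rewrite -RintZ//; apply: Rint_le => //; first exact: igrZ.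
  move=> x; rewrite [leRHS]mulrCA; apply: ler_wpM2l => //.
  by apply: le_trans (ubd x); exact: ler_norm.
have aQ : 0 <= a * Q * (2 * th).
  by apply: mulr_ge0; apply: mulr_ge0 => //; exact: ltW.
apply: (le_trans (ler_wpM2l aQ HF)).
have H : \int[mu]_x (a * Num.max (f x) 0) <= \int[mu]_x (Num.max (f x) 0 * u x).
  apply: Rint_le => //; first exact: igrZ.
  by move=> x; rewrite mulrC ler_wpM2l//; have /andP[] := au x.
rewrite RintZ// in H.
have -> : a * Q * (2 * th) * (CF * \int[mu]_x Num.max (f x) 0) =
   2 * th * Q * CF * (a * \int[mu]_x Num.max (f x) 0) by ring.
by rewrite ler_wpM2l// mulr_ge0// mulr_ge0 ?(ltW Q0)// mulr_ge0.
Qed.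

Lemma coneG_difference (u v w : X -> R) a b :
  tempered E Q u -> tempered E Q v ->
  measurable_fun setT w -> {ae mu, forall x, w x = a * u x - b * v x} ->
  (forall f, F f -> b * \int[mu]_x (Num.max (f x) 0 * v x) <=
                    a * \int[mu]_x (Num.max (f x) 0 * u x)) ->
  G w.
Proof.
move=> [mu_ [s s0 su]] [mv [t t0 tv]] mw wE H.
have u0 x : 0 < u x by have /andP[/(lt_le_trans s0)] := su x.
have v0 x : 0 < v x by have /andP[/(lt_le_trans t0)] := tv x.
apply: (@coneG_intro w (fun x => a * u x - b * v x)
   (`|a| * (s * Q) + `|b| * (t * Q))) => //.
- by apply: measurable_funB; exact: measurable_funM.
- move=> x; apply: (le_trans (ler_normB _ _)); rewrite mulrDl !normrM.
  rewrite (gtr0_norm (u0 x)) (gtr0_norm (v0 x)) -!mulrA.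
  by apply: lerD; apply: ler_wpM2l => //; [have /andP[] := su x|have /andP[] := tv x].
move=> f Ff.
have iu : igr (fun x => Num.max (f x) 0 * u x).
  apply: (@coneF_integrable _ _ (s * Q) 1) => // x.
  by rewrite gtr0_norm// -mulrA; have /andP[] := su x.
have iv : igr (fun x => Num.max (f x) 0 * v x).
  apply: (@coneF_integrable _ _ (t * Q) 1) => // x.
  by rewrite gtr0_norm// -mulrA; have /andP[] := tv x.
under eq_Rintegral do rewrite mulrBr !(mulrCA (Num.max _ _)).
rewrite RintB; [|exact: igrZ|exact: igrZ].
by rewrite !RintZ// subr_ge0; exact: H.
Qed.

(** With [t = 2 th Q CF], the witnesses for the two sides of Hilbert's metric are [exp (- lam + t)]
    and [exp (- lam - t)]. Their quotient [exp (2 t)] is free of [lam], as a projective quantity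
    must be. *)
Lemma hilbert_dist_tempered (u v v' : X -> R) lam th be :
  tempered E Q u -> tempered E Q v ->
  measurable_fun setT v' -> {ae mu, forall x, v' x = v x} ->
  0 <= th -> 0 < be <= 1 ->
  (forall x, `|ln (u x) - ln (v x) - lam| <= th * (1 + be * E x ^+ 2)) ->
  (hilbert_dist mu G v' u <= (4 * th * Q * CF)%:E)%E.
Proof.
move=> tu tv mv' v'v th0 be01 uv.
set t := 2 * th * Q * CF.
have t0 : 0 <= t by rewrite mulr_ge0// mulr_ge0 ?(ltW Q0)// mulr_ge0.
have vu x : `|ln (v x) - ln (u x) - (- lam)| <= th * (1 + be * E x ^+ 2).
  by rewrite (_ : _ - _ = - (ln (u x) - ln (v x) - lam)) ?normrN//; ring.
have mu_ : measurable_fun setT u by case: tu.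
have Huv f : F f -> \int[mu]_x (Num.max (f x) 0 * u x) <=
    expR (lam + t) * \int[mu]_x (Num.max (f x) 0 * v x).
  by move=> Ff; exact: (coneF_ratio Ff tu tv th0 be01 uv).
have Hvu f : F f -> \int[mu]_x (Num.max (f x) 0 * v x) <=
    expR (- lam + t) * \int[mu]_x (Num.max (f x) 0 * u x).
  by move=> Ff; exact: (coneF_ratio Ff tv tu th0 be01 vu).
apply: (@hilbert_dist_le _ _ _ (expR (- lam - t)) (expR (- lam + t)) (expR (lam + t))).
- exact: expR_gt0.
- exact: expR_gt0.
- exact: expR_gt0.
- apply: (coneG_difference (a := expR (- lam + t)) (b := 1) tu tv).
  + by apply: measurable_funB => //; exact: measurable_funM.
  + by apply: filterS v'v => x ->; rewrite mul1r.
  + by move=> f Ff; rewrite mul1r; exact: Hvu.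
- apply: (coneG_difference (a := 1) (b := expR (- lam - t)) tv tu).
  + by apply: measurable_funB => //; exact: measurable_funM.
  + by apply: filterS v'v => x ->; rewrite mul1r.
  + move=> f Ff; rewrite mul1r -opprD expRN ler_pdivrMl ?expR_gt0//.
    exact: Huv.
- apply: (coneG_difference (a := expR (lam + t)) (b := 1) tv tu).
  + by apply: measurable_funB => //; exact: measurable_funM.
  + by apply: filterS v'v => x ->; rewrite mul1r.
  + by move=> f Ff; rewrite mul1r; exact: Huv.
- have [_ [a a0 au]] := tu.
  by move=> /ae_exists[x ux]; have /andP[] := au x; rewrite ux leNgt a0.
- by rewrite mulr_ge0// mulr_ge0 ?(ltW Q0)// mulr_ge0.
rewrite -expRN -expRD ler_expR /t; lra.
Qed.

End hilbert.

(** * Tails and exponential moments *)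

Section exponential_moment.
Context {R : realType} {d : measure_display} {X : measurableType d}.
Variable mu : {measure set X -> \bar R}.

Lemma half_geometric_sum n : \sum_(0 <= i < n) (2^-1 : R) ^+ i <= 2.
Proof.
suff -> : \sum_(0 <= i < n) (2^-1 : R) ^+ i = 2 - 2 * 2^-1 ^+ n.
  by rewrite lerBlDr lerDl mulr_ge0// exprn_ge0// invr_ge0.
elim: n => [|n IH]; first by rewrite big_nil expr0; lra.
by rewrite big_nat_recr//= IH exprS; field.
Qed.

(* Slicing along the level sets [{j < s}]: on [{j < s <= j + 1}] the integrand is
   at most [f * expR (a * (j + 1))]. *)
Lemma exponential_moment_le (s f : X -> R) (a I : R) (j0 : nat) :
  measurable_fun setT s -> measurable_fun setT f -> (forall x, 0 <= f x) ->
  0 <= a -> 0 <= I ->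
  (\int[mu]_x (f x)%:E <= I%:E)%E ->
  (forall j, (j0 <= j)%N ->
    (\int[mu]_(x in [set x | (j%:R < s x)%R]) (f x)%:E <=
      (expR (- ((a + 1) * j%:R)) * I)%:E)%E) ->
  (\int[mu]_x (f x * expR (a * s x))%:E <=
    ((expR (a * j0%:R) + 2 * expR a) * I)%:E)%E.
Proof.
move=> ms mf f0 a0 I0 fI tail.
have mD (j : nat) : measurable [set x | j%:R < s x].
  have := measurable_fun_ltr (@measurable_cst _ _ _ _ setT (j%:R : R)) ms.
  by move=> /(_ measurableT [set true]); rewrite setTI; exact.
pose W (j : nat) := expR (a * (j0 + j).+1%:R).
pose g (j : nat) (x : X) : \bar R :=
  ((W j)%:E * ((EFin \o f) \_ [set x | ((j0 + j)%:R < s x)%R]) x)%E.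
have mg j : measurable_fun setT (g j).
  apply: measurable_funeM; apply/(measurable_restrictT _ _).1 => //.
  by apply/measurable_EFinP; exact: measurable_funTS.
have g0 j x : (0 <= g j x)%E.
  rewrite mule_ge0 ?lee_fin ?expR_ge0//.
  by apply: erestrict_ge0 => y _; rewrite lee_fin.
have gI j : (\int[mu]_x g j x <= (expR a * I * 2^-1 ^+ j)%:E)%E.
  rewrite ge0_integralZl//; last 3 first.
  - apply/(measurable_restrictT _ _).1 => //.
    by apply/measurable_EFinP; exact: measurable_funTS.
  - by move=> x _; apply: erestrict_ge0 => y _; rewrite lee_fin.
  - by rewrite lee_fin expR_ge0.
  rewrite -integral_mkcond.
  have := tail (j0 + j)%N (leq_addr _ _).
  move=> /(lee_wpmul2l (expR_ge0 (a * (j0 + j).+1%:R) : (0 <= (W j)%:E)%E)).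
  move=> /le_trans; apply.
  rewrite -EFinM lee_fin mulrA -expRD mulrAC ler_wpM2r//.
  (* The tail rate exceeds the growth rate [a] by one, which leaves [exp (- j) <= 2^-j]. *)
  have -> : a * (j0 + j).+1%:R + - ((a + 1) * (j0 + j)%:R) = a - j0%:R + - j%:R.
    by rewrite -(addn1 (j0 + j)) !natrD; ring.
  rewrite expRD; apply: ler_pM; rewrite ?expR_ge0//.
    by rewrite ler_expR lerBlDr lerDl.
  rewrite -mulrN1 expRM_natl lerXn2r ?nnegrE ?expR_ge0 ?invr_ge0//.
  rewrite expRN lef_pV2 ?posrE ?expR_gt0//.
  by have := expR_ge1Dx (1 : R); lra.
have pw x : ((f x * expR (a * s x))%:E <=
    (expR (a * j0%:R) * f x)%:E + \sum_(j <oo) g j x)%E.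
  have S0 : (0 <= \sum_(j <oo) g j x)%E by exact: nneseries_ge0.
  have [sj|js] := leP (s x) j0%:R.
    apply: (@le_trans _ _ (expR (a * j0%:R) * f x)%:E); last by rewrite leeDl.
    by rewrite lee_fin mulrC ler_wpM2r// ler_expR ler_wpM2l.
  have ex : exists n, s x <= n%:R.
    by exists (Num.bound (s x)); apply: ltW; apply: le_lt_trans (archi_boundP _);
      rewrite ?normr_ge0// (le_trans _ (ltW js)).
  (* By minimality [n - 1 < s x <= n], so the slice of index [j = n - 1 - j0] contains [x], and its
     weight [exp (a * n)] dominates. *)
  case: (ex_minnP ex) => n sn nmin.
  have j0n : (j0 < n)%N by rewrite -(ltr_nat R); exact: lt_le_trans sn.
  have nE : n = (j0 + (n - j0.+1)).+1 by rewrite -addnS -subSn// subSS subnKC// ltnW.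
  set j := (n - j0.+1)%N in nE.
  have js' : (j0 + j)%:R < s x.
    rewrite ltNge; apply/negP => /nmin; rewrite nE ltnn//.
  apply: (@le_trans _ _ (g j x)).
    rewrite /g /W patchE ifT; last by rewrite inE.
    rewrite -EFinM lee_fin mulrC ler_wpM2r// ler_expR ler_wpM2l//.
    by rewrite -nE.
  apply: (@le_trans _ _ (\sum_(j <oo) g j x)%E); last first.
    by rewrite leeDr// lee_fin mulr_ge0// expR_ge0.
  apply: le_trans (nneseries_lim_ge j.+1 _) => //.
  by rewrite big_nat_recr//= leeDr// sume_ge0.
have mgs : measurable_fun setT (fun x => \sum_(j <oo) g j x)%E.
  by apply: ge0_emeasurable_sum => // j x _ _; exact: g0.
apply: (@le_trans _ _ (\int[mu]_x
    ((expR (a * j0%:R) * f x)%:E + \sum_(j <oo) g j x))%E).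
  apply: ge0_le_integral => //.
  - by move=> x _; rewrite lee_fin mulr_ge0// expR_ge0.
  - apply/measurable_EFinP; apply: measurable_funM => //.
    by apply: measurableT_comp => //; exact: measurable_funM.
  - apply: emeasurable_funD => //.
    by apply/measurable_EFinP; exact: measurable_funM.
rewrite ge0_integralD//; last 3 first.
- by move=> x _; rewrite lee_fin mulr_ge0// expR_ge0.
- by apply/measurable_EFinP; exact: measurable_funM.
- by move=> x _; exact: nneseries_ge0.
rewrite mulrDl EFinD; apply: leeD.
  under eq_integral do rewrite EFinM.
  rewrite ge0_integralZl//; last 2 first.
  - exact/measurable_EFinP.
  - by move=> x _; rewrite lee_fin.
  by rewrite EFinM; apply: lee_wpmul2l => //; rewrite lee_fin expR_ge0.
rewrite integral_nneseries//.
have ig0 j : (0 <= \int[mu]_x g j x)%E by exact: integral_ge0.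
apply: lime_le.
  by apply: is_cvg_nneseries => j _ _.
apply: nearW => n.
apply: (@le_trans _ _ (\sum_(0 <= j < n) (expR a * I * 2^-1 ^+ j)%:E)%E).
  by apply: lee_sum => j _.
rewrite sumEFin lee_fin -mulr_sumr.
have -> : 2 * expR a * I = expR a * I * 2 by ring.
by rewrite ler_wpM2l ?half_geometric_sum// mulr_ge0// expR_ge0.
Qed.

End exponential_moment.

(** * Level sets of the distance and the two growth hypotheses *)

Section metric.
Context {R : realType} {d : measure_display} {X : measurableType d}.
Variables (dX : X -> X -> R) (x0 : X).
Hypothesis pX : polish_borel dX.

Lemma dist_ge0 x y : 0 <= dX x y. Proof. by case: pX => -[+ _ _ _] _ _ _; exact. Qed.

Lemma measurable_dist : measurable_fun setT (dX x0).
Proof.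
case: pX => -[_ _ _ tri] _ _ borel.
apply: (measurability _ (RGenOInfty.measurableE R)) => _ [_ [r ->] <-].
rewrite setTI; apply/borel; apply: sub_sigma_algebra => x /=.
rewrite in_itv/= andbT => rx; exists (dX x0 x - r); split; first by rewrite subr_gt0.
move=> y /= xy; rewrite in_itv/= andbT.
have := tri x0 y x; have [_ _ sym _] : is_metric dX by case: pX.
by rewrite (sym y x); lra.
Qed.

Variable p : R.
Hypothesis p0 : 0 < p.

Lemma measurable_dist_powR : measurable_fun setT (fun x => dX x0 x `^ p).
Proof. exact: (measurableT_comp (@measurable_powR R p) measurable_dist). Qed.

Lemma measurable_level (t : R) : measurable [set x | (t < dX x0 x `^ p)%R].
Proof.
have := measurable_fun_ltr (@measurable_cst _ _ _ _ setT t) measurable_dist_powR.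
by move=> /(_ measurableT [set true]); rewrite setTI; exact.
Qed.

Lemma powR_rootK (t : R) : 0 <= t -> (t `^ p^-1) `^ p = t.
Proof. by move=> t0; rewrite -powRrM mulVf ?gt_eqF// powRr1. Qed.

Lemma powR_lt (x y : R) : 0 <= x -> 0 <= y -> (x `^ p < y `^ p) = (x < y).
Proof.
move=> x_ge0 y_ge0; have [xy|yx] := ltP x y.
  by apply: gt0_ltr_powR => //; rewrite ?nnegrE.
by apply/negbTE; rewrite -leNgt; apply: ge0_ler_powR => //; rewrite ?nnegrE// ltW.
Qed.

Lemma ball_setC (t : R) : 0 <= t ->
  ~` ball_r dX x0 (t `^ p^-1) = [set x | (t < dX x0 x `^ p)%R].
Proof.
move=> t0; apply/seteqP; split => x /=.
  move/negP; rewrite -ltNge => tx.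
  by rewrite -(powR_rootK t0) powR_lt ?powR_ge0 ?dist_ge0.
rewrite -{1}(powR_rootK t0) powR_lt ?powR_ge0 ?dist_ge0// => tx.
by apply/negP; rewrite -ltNge.
Qed.

(** The limit is used once, to get [c <= r^p] on the ball of radius [r] for all [r >= r0]. With [r]
    the maximum of [r0] and the two distances, [r^p] is one of the three summands. *)
Lemma cost_le (c : X * X -> R) :
  (ereal_sup [set (c z)%:E | z in ball_r dX x0 r `*` ball_r dX x0 r]
     * ((r `^ p)^-1)%:E)%E @[r --> +oo] --> 0%E ->
  exists2 L, 0 <= L & forall x y, c (x, y) <= L + dX x0 x `^ p + dX x0 y `^ p.
Proof.
move=> H.
have /H[M [_ HM]] : nbhs 0%E [set u : \bar R | (u < 1)%E].
  apply: open_nbhs_nbhs; split; first exact: open_ereal_lt_ereal.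
  by rewrite /= lte_fin.
pose r0 := Num.max M 0 + 1.
have r00 : 0 < r0 by rewrite ltr_pwDr// le_max lexx orbT.
have Mr0 : M < r0 by rewrite ltr_pwDr// le_max lexx.
exists (r0 `^ p); first exact: powR_ge0.
move=> x y; pose r := Num.max r0 (Num.max (dX x0 x) (dX x0 y)).
have r0r : r0 <= r by rewrite le_max lexx.
have rp0 : 0 < r `^ p by rewrite powR_gt0// (lt_le_trans r00).
have xr : dX x0 x <= r by rewrite !le_max lexx orbT.
have yr : dX x0 y <= r by rewrite !le_max lexx !orbT.
have := HM r (lt_le_trans Mr0 r0r) => /= Hr.
have : ((c (x, y))%:E * ((r `^ p)^-1)%:E < 1)%E.
  apply: le_lt_trans Hr; apply: lee_wpmul2r; first by rewrite lee_fin invr_ge0 ltW.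
  by apply: ereal_sup_ubound; exists (x, y).
rewrite -EFinM lte_fin ltr_pdivrMr// mul1r => /ltW /le_trans; apply.
have := powR_ge0 r0 p; have := powR_ge0 (dX x0 x) p; have := powR_ge0 (dX x0 y) p.
have rE : r = r0 \/ r = dX x0 x \/ r = dX x0 y.
  rewrite /r; case: (leP r0 (Num.max _ _)) => _; last by left.
  by right; case: (leP (dX x0 x) (dX x0 y)) => _; [right|left].
by case: rE => [|[]] ->; lra.
Qed.

Lemma tail_le (m : probability X R) (delta a : R) (F : R -> R) : 0 < delta -> 0 <= a ->
  (forall r, fine (m (~` ball_r dX x0 r)) <= F r) ->
  (F r / expR (- r `^ (p + delta))) @[r --> +oo] --> (0 : R) ->
  exists j0 : nat, forall t : R, j0%:R <= t ->
    (m [set x | (t < dX x0 x `^ p)%R] <= (expR (- ((a + 1) * t)))%:E)%E.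
Proof.
move=> delta0 a0 mF /cvgr_lt /(_ 1 ltr01) [M [_ HM]].
(* With [t = r^p] one has [r^(p + delta) = t * r^delta]. The first entry puts [r] beyond the
   threshold of the limit, the second makes [r^delta >= a + 1]; any exponential rate in [t] is thus
   reached. *)
pose S := Num.max (Num.max M 0 `^ p) ((a + 1) `^ (p / delta)).
have S0 : 0 <= S by rewrite le_max powR_ge0.
exists (Num.bound S).+1 => t tS.
have St : S < t.
  apply: lt_le_trans tS; apply: (@lt_trans _ _ (Num.bound S)%:R).
    exact: archi_boundP.
  by rewrite ltr_nat.
have t0 : 0 <= t by apply: le_trans (ltW St).
pose r := t `^ p^-1.
have rM : M < r.
  apply: (@le_lt_trans _ _ (Num.max M 0)); first by rewrite le_max lexx.
  rewrite -powR_lt ?powR_ge0 ?le_max ?lexx ?orbT//.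
  by rewrite powR_rootK//; apply: le_lt_trans St; rewrite le_max lexx.
have := HM r rM; rewrite /= ltr_pdivrMr ?expR_gt0// mul1r => /ltW Hr.
rewrite -ball_setC//.
have fm : m (~` ball_r dX x0 r) \is a fin_num.
  by apply: fin_num_measure; rewrite ball_setC//; exact: measurable_level.
rewrite -(fineK fm) lee_fin; apply: (le_trans (mF r)); apply: (le_trans Hr).
rewrite ler_expR lerN2 powRD; last first.
  by apply/implyP => _; rewrite powR_eq0 negb_and gt_eqF// (le_lt_trans S0).
rewrite powR_rootK// mulrC ler_wpM2l//.
have -> : r `^ delta = t `^ (delta / p) by rewrite /r -powRrM mulrC.
have -> : a + 1 = ((a + 1) `^ (p / delta)) `^ (delta / p).
  rewrite -powRrM (_ : p / delta * (delta / p) = 1) ?powRr1//; first by lra.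
  by field; rewrite !gt_eqF.
apply: ge0_ler_powR; rewrite ?nnegrE ?powR_ge0//.
  by rewrite divr_ge0// ltW.
by apply: ltW; apply: le_lt_trans St; rewrite le_max lexx orbT.
Qed.

Lemma tail_function_exp (b : R) : 0 < b ->
  tail_function (fun r => expR (- (b * r `^ p))).
Proof.
move=> b0; split.
- move=> r s r0 rs; rewrite ler_expR lerN2 ler_wpM2l ?(ltW b0)//.
  apply: ge0_ler_powR => //; rewrite ?nnegrE ?ltW//.
  exact: lt_le_trans rs.
- by move=> r _; exact: expR_ge0.
apply/cvgr0Pnorm_lt => e e0.
exists ((e^-1 / b) `^ p^-1); split; first exact: num_real.
move=> r Mr; rewrite gtr0_norm ?expR_gt0// expRN -[X in _ < X]invrK.
rewrite ltf_pV2 ?posrE ?invr_gt0 ?expR_gt0//.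
have eb0 : 0 <= e^-1 / b by rewrite divr_ge0 ?invr_ge0// ltW.
have : e^-1 / b < r `^ p.
  rewrite -{1}(powR_rootK eb0) powR_lt ?powR_ge0//.
  by apply: le_trans (ltW Mr); exact: powR_ge0.
rewrite ltr_pdivrMr// mulrC => H.
by apply: (lt_le_trans H); apply: le_trans (expR_ge1Dx _); lra.
Qed.

(* On the cone with [alphat = 0] functions are nonnegative, and [alpha] decays
   fast enough to give a uniform exponential moment. *)
Lemma coneF_moment (m : probability X R) (a : R) (j0 : nat) (f : X -> R) :
  0 <= a ->
  let r0 := j0%:R `^ p^-1 in
  coneF m (ball_r dX x0) r0 r0 (fun r => expR (- ((a + 1) * r `^ p))) (fun=> 0) f ->
  {ae m, forall x, 0 <= f x} /\
  m.-integrable setT (EFin \o (fun x => Num.max (f x) 0 * expR (a * dX x0 x `^ p))) /\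
  \int[m]_x (Num.max (f x) 0 * expR (a * dX x0 x `^ p)) <=
    (expR (a * j0%:R) + 2 * expR a) * \int[m]_x (Num.max (f x) 0).
Proof.
move=> a0 r0 [[mf f2] fB ftail fneg].
have ms := measurable_dist_powR.
have mfp : measurable_fun setT (fun x => Num.max (f x) 0) by exact: measurable_maxr.
have mfn : measurable_fun setT (fun x => Num.max (- f x) 0).
  by apply: measurable_maxr => //; exact: measurableT_comp.
have mball : measurable (~` ball_r dX x0 r0).
  by rewrite ball_setC//; exact: measurable_level.
have fae : {ae m, forall x, 0 <= f x}.
  have := fneg r0 (lexx _); rewrite mul0e => fneg0.
  have : ae_eq m (~` ball_r dX x0 r0) (fun x => (Num.max (- f x) 0)%:E) (cst 0%E).
    apply/ae_eq_integral_abs => //; first exact/measurable_EFinP/measurable_funTS.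
    apply/eqP; rewrite eq_le; apply/andP; split; last exact: integral_ge0.
    under eq_integral do rewrite gee0_abs ?lee_fin ?le_max ?lexx ?orbT//.
    exact: fneg0.
  apply: filterS2 fB => x fBx fCx.
  have [/fBx //|/fCx [] H] := pselect (ball_r dX x0 r0 x).
  by rewrite -oppr_le0 -H le_max lexx.
have ifp : m.-integrable setT (EFin \o (fun x => Num.max (f x) 0)).
  have if2 : m.-integrable setT (EFin \o (fun x => f x ^+ 2)).
    apply/integrableP; split; first by apply/measurable_EFinP; exact: measurable_funX.
    under eq_integral do rewrite /= ger0_norm ?sqr_ge0//.
    exact: f2.
  have i1 : m.-integrable setT (EFin \o (fun=> 1 : R)).
    apply/integrableP; split; first exact/measurable_EFinP/measurable_cst.
    rewrite /= normr1 integral_cst// mul1e.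
    by rewrite [X in (X < _)%E](_ : _ = 1%E) ?ltry//; exact: probability_setT.
  apply: (igr_le mfp (igrD i1 if2)) => x.
  rewrite ger0_norm ?le_max ?lexx ?orbT// ge_max addr_ge0 ?sqr_ge0// andbT.
  by have := sqr_ge0 (f x - 1); have := sqr_ge0 (f x); lra.
set I := \int[m]_x (Num.max (f x) 0).
have I0 : 0 <= I by apply: Rintegral_ge0 => x _; rewrite le_max lexx orbT.
have IE : (\int[m]_x (Num.max (f x) 0)%:E = I%:E)%E.
  by rewrite /I /Rintegral fineK//; exact: (integrable_fin_num measurableT ifp).
have fE : (\int[m]_x (f x)%:E = I%:E)%E.
  rewrite -IE; apply: ae_eq_integral => //; try exact/measurable_EFinP.
  by apply: filterS fae => x /max_idPl ->.
have fp0 x : 0 <= Num.max (f x) 0 by rewrite le_max lexx orbT.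
have tail j : (j0 <= j)%N ->
    (\int[m]_(x in [set x | (j%:R < dX x0 x `^ p)%R]) (Num.max (f x) 0)%:E <=
      (expR (- ((a + 1) * j%:R)) * I)%:E)%E.
  move=> j0j; rewrite -ball_setC//.
  (* At the radius [j^(1/p)], admissible because [j >= j0], the value of [alpha] is exactly the tail
     required for slicing. *)
  have := ftail (j%:R `^ p^-1); rewrite powR_rootK// fE -EFinM; apply.
  by apply: ge0_ler_powR; rewrite ?nnegrE ?invr_ge0 ?(ltW p0)// ler_nat.
have IE' : (\int[m]_x (Num.max (f x) 0)%:E <= I%:E)%E by rewrite IE.
have mom := exponential_moment_le ms mfp fp0 a0 I0 IE' tail.
have me : measurable_fun setT (fun x => Num.max (f x) 0 * expR (a * dX x0 x `^ p)).
  apply: measurable_funM => //; apply: measurableT_comp => //.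
  exact: measurable_funM.
have ie : m.-integrable setT
    (EFin \o (fun x => Num.max (f x) 0 * expR (a * dX x0 x `^ p))).
  apply/integrableP; split; first exact/measurable_EFinP.
  under eq_integral do rewrite /= ger0_norm ?mulr_ge0 ?expR_ge0//.
  by apply: le_lt_trans mom _; exact: ltry.
split=> //; split=> //.
by rewrite -lee_fin; apply: le_trans mom; rewrite /Rintegral fineK//;
  exact: (integrable_fin_num measurableT ie).
Qed.

End metric.

(** * The Schroedinger equations *)

Section schroedinger_map.
Context {R : realType} {d : measure_display} {X : measurableType d}.
Variables (m : probability X R) (c : X * X -> R) (eps : R) (E : X -> R).
Hypothesis mc : measurable_fun setT c.
Hypothesis mE : measurable_fun setT E.
Hypothesis E1 : forall x, 1 <= E x.
Hypothesis cE : forall x y, (E x * E y)^-1 <= expR (- c (x, y) / eps).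
Local Notation kap x y := (expR (- c (x, y) / eps)).
Local Notation igr f := (m.-integrable setT (EFin \o f)).

Let E0 x : 0 < E x. Proof. exact: lt_le_trans ltr01 (E1 x). Qed.

Lemma kernel_weight_le x y : (E x)^-1 <= E y * kap x y.
Proof. by rewrite -ler_pdivrMl// mulrC -invfM; exact: cE. Qed.

Lemma measurable_kernel_mul (g : X -> R) y : measurable_fun setT g ->
  measurable_fun setT (fun x => kap x y * g x).
Proof. by move=> mg; apply: measurable_funM => //; exact: measurable_kernel1. Qed.

Lemma mass_finite_integrable (g : X -> R) y : (forall x, 0 < g x) ->
  measurable_fun setT g -> (\int[m]_x (kap x y * g x)%:E != +oo)%E ->
  igr (fun x => kap x y * g x).
Proof.
move=> g0 mg Iy; apply/integrableP; split.
  by apply/measurable_EFinP; exact: measurable_kernel_mul.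
under eq_integral do rewrite /= ger0_norm ?mulr_ge0 ?expR_ge0 ?(ltW (g0 _))//.
by rewrite ltey.
Qed.

(** A nonzero value excludes the default [0], so the mass at this single [y] is finite; the lower
    bound on the kernel turns that into integrability against [1 / E]. *)
Lemma T_mu_neq0_integrable (g : X -> R) y : (forall x, 0 < g x) ->
  measurable_fun setT g -> T_mu m c eps g y != 0 -> igr (fun x => (E x)^-1 * g x).
Proof.
move=> g0 mg; rewrite /T_mu; case: ifP => [|/negbT Iy _]; first by rewrite eqxx.
apply: (igr_le _ (igrZ (E y) (mass_finite_integrable g0 mg Iy))) => [|x].
  by apply: measurable_funM => //; exact: measurable_recip.
rewrite ger0_norm ?mulr_ge0 ?invr_ge0 ?(ltW (E0 _)) ?(ltW (g0 _))//.
by rewrite mulrA ler_wpM2r ?(ltW (g0 _))// kernel_weight_le.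
Qed.

(* As [T_mu_le], but [g] itself is not assumed integrable: where the mass is
   infinite [T_mu] takes its junk value [0]. *)
Lemma T_mu_le_weighted (g : X -> R) y : (forall x, 0 < g x) ->
  measurable_fun setT g -> igr (fun x => (E x)^-1 * g x) ->
  T_mu m c eps g y <= E y * (\int[m]_x ((E x)^-1 * g x))^-1.
Proof.
move=> g0 mg iw.
have w0 : 0 < \int[m]_x ((E x)^-1 * g x).
  by apply: Rint_gt0 => // x; rewrite mulr_gt0// invr_gt0.
have [Iy|Iy] := eqVneq (\int[m]_x (kap x y * g x)%:E)%E +oo%E.
  rewrite /T_mu Iy eqxx mulr_ge0 ?invr_ge0 ?(ltW w0)//; exact: ltW.
have ik := mass_finite_integrable g0 mg Iy.
have k0 : 0 < \int[m]_x (kap x y * g x).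
  by apply: Rint_gt0 => // x; rewrite mulr_gt0// expR_gt0.
rewrite T_muE// -[X in X * _]invrK -invfM lef_pV2 ?posrE ?mulr_gt0 ?invr_gt0//.
rewrite mulrC ler_pdivrMr// mulrC -RintZ//; apply: Rint_le => //; first exact: igrZ.
by move=> x; rewrite mulrA ler_wpM2r ?(ltW (g0 _))// kernel_weight_le.
Qed.

(** Integration forgets null sets while [T] is defined at every point; this upgrades equations from
    almost everywhere to everywhere. *)
Lemma T_mu_ae (g g' : X -> R) : measurable_fun setT g -> measurable_fun setT g' ->
  {ae m, forall x, g x = g' x} -> T_mu m c eps g = T_mu m c eps g'.
Proof.
move=> mg mg' gg'; apply/funext => y; rewrite /T_mu.
suff -> : (\int[m]_x (kap x y * g x)%:E = \int[m]_x (kap x y * g' x)%:E)%E by [].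
apply: ae_eq_integral => //; try exact/measurable_EFinP/measurable_kernel_mul.
by apply: filterS gg' => x ->.
Qed.

Lemma ae_dominated_integrable (g : X -> R) C :
  measurable_fun setT g -> igr E -> (forall x, 0 < g x) ->
  {ae m, forall x, g x <= C * E x} -> igr g.
Proof.
move=> mg iE g0 gC; apply/integrableP; split; first exact/measurable_EFinP.
apply: (@le_lt_trans _ _ (\int[m]_x (`|C| * E x)%:E)%E); last first.
  exact: integrable_lty (igrZ `|C| iE).
apply: ae_ge0_le_integral => //.
- exact/measurable_EFinP/measurableT_comp.
- by move=> x _; rewrite lee_fin mulr_ge0// ltW.
- by apply/measurable_EFinP; exact: measurable_funM.
apply: filterS gC => x gx _ /=; rewrite lee_fin gtr0_norm//.
by apply: (le_trans gx); rewrite ler_wpM2r ?ler_norm// ltW.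
Qed.

End schroedinger_map.

Section schroedinger.
Context {R : realType} {d : measure_display} {X : measurableType d}.
Variables (mu nu : probability X R) (c : X * X -> R) (eps : R).
Variables (E : X -> R) (J : R).
Hypothesis eps0 : 0 < eps.
Hypothesis c0 : forall z, 0 <= c z.
Hypothesis mc : measurable_fun setT c.
Hypothesis mE : measurable_fun setT E.
Hypothesis E1 : forall x, 1 <= E x.
Hypothesis imu : mu.-integrable setT (EFin \o (fun x => E x ^+ 3)).
Hypothesis muJ : \int[mu]_x (E x ^+ 3) <= J.
Hypothesis inu : nu.-integrable setT (EFin \o (fun x => E x ^+ 3)).
Hypothesis nuJ : \int[nu]_x (E x ^+ 3) <= J.
Hypothesis cE : forall x y, (E x * E y)^-1 <= expR (- c (x, y) / eps).
Variables g1 g2 : X -> R.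
Hypothesis g10 : forall x, 0 < g1 x.
Hypothesis g20 : forall x, 0 < g2 x.
Hypothesis mg1 : measurable_fun setT g1.
Hypothesis mg2 : measurable_fun setT g2.
Hypothesis g1E : {ae mu, forall x, g1 x = T_nu nu c eps g2 x}.
Hypothesis g2E : {ae nu, forall y, g2 y = T_mu mu c eps g1 y}.

Let c' (z : X * X) := c (z.2, z.1).
Let c'0 z : 0 <= c' z. Proof. exact: c0. Qed.
Let mc' : measurable_fun setT c'.
Proof. exact: (measurableT_comp mc (@measurable_swap _ _ X X)). Qed.
Let c'E x y : (E x * E y)^-1 <= expR (- c' (x, y) / eps).
Proof. by rewrite mulrC; exact: cE. Qed.

(** Put [h1 = T_nu g2] and [h2 = T_mu h1]. As [h1 = g1] almost everywhere, [h2 = T_mu g1], which is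
    [g2] almost everywhere; hence [T_nu h2 = T_nu g2 = h1] at every point. *)
Lemma schroedinger_exact : exists Q h1 h2,
  [/\ 4 * J ^+ 2 <= Q, h1 = T_nu nu c eps h2 /\ h2 = T_mu mu c eps h1,
      admissible E Q mu h1 /\ admissible E Q nu h2,
      {ae mu, forall x, g1 x = h1 x} & {ae nu, forall y, g2 y = h2 y}].
Proof.
have E0 x : 0 < E x by exact: lt_le_trans ltr01 (E1 x).
have iE (m : probability X R) : m.-integrable setT (EFin \o (fun x => E x ^+ 3)) ->
    m.-integrable setT (EFin \o E).
  by move=> im; exact: (@weight_integrable _ _ _ m E mE E1 im 1).
(* Integrability of [g2] is extracted from positivity: one point where each equation holds makes
   both weighted integrals finite, and then [g2] is dominated by a multiple of [E]. *)
have iw2 : nu.-integrable setT (EFin \o (fun x => (E x)^-1 * g2 x)).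
  have [x g1x] := ae_exists g1E.
  apply: (T_mu_neq0_integrable (y := x) mc' mE E1 c'E g20 mg2).
  by rewrite -[T_mu _ _ _ _ _]/(T_nu nu c eps g2 x) -g1x gt_eqF.
have ig2 : nu.-integrable setT (EFin \o g2).
  have [y g2y] := ae_exists g2E.
  have iw1 : mu.-integrable setT (EFin \o (fun x => (E x)^-1 * g1 x)).
    apply: (T_mu_neq0_integrable (y := y) mc mE E1 cE g10 mg1).
    by rewrite -g2y gt_eqF.
  apply: (ae_dominated_integrable mE E1 mg2 (iE _ inu) g20
    (C := (\int[mu]_x ((E x)^-1 * g1 x))^-1)).
  apply: filterS g2E => z ->; rewrite mulrC.
  exact: (T_mu_le_weighted mc E1 cE).
have W0 : 0 < \int[nu]_x ((E x)^-1 * g2 x).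
  by apply: Rint_gt0 => // x; rewrite mulr_gt0// invr_gt0.
have G0 : 0 <= \int[nu]_x g2 x by apply: Rintegral_ge0 => x _; exact: ltW.
pose q := \int[nu]_x g2 x / \int[nu]_x ((E x)^-1 * g2 x).
have q0 : 0 <= q by rewrite divr_ge0// ltW.
have J20 : 0 <= J ^+ 2 by exact: sqr_ge0.
(* The first term makes balance stable under [T]; the second makes [g2] itself balanced. *)
pose Q := 4 * J ^+ 2 + q.
have JQ : 4 * J ^+ 2 <= Q by rewrite lerDl.
have b2 : balanced E Q nu g2.
  by split=> //; rewrite -ler_pdivrMr// lerDr mulr_ge0.
pose h1 := T_nu nu c eps g2.
have a1 : admissible E Q mu h1.
  exact: (T_mu_admissible eps0 c'0 mc' mE E1 inu nuJ imu muJ c'E JQ b2).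
pose h2 := T_mu mu c eps h1.
have a2 : admissible E Q nu h2.
  by apply: (T_mu_admissible eps0 c0 mc mE E1 imu muJ inu nuJ cE JQ); case: a1.
have mh1 : measurable_fun setT h1 by case: a1 => -[].
have mh2 : measurable_fun setT h2 by case: a2 => -[].
have h2E : h2 = T_mu mu c eps g1.
  by apply/esym; exact: (T_mu_ae eps mc mg1 mh1).
have g2h2 : {ae nu, forall y, g2 y = h2 y} by rewrite h2E.
exists Q, h1, h2; split=> //; split=> //.
exact: (T_mu_ae eps mc').
Qed.

Lemma plan_density_ae (u v h1 h2 : X -> R) :
  measurable_fun setT u -> measurable_fun setT v ->
  measurable_fun setT h1 -> measurable_fun setT h2 ->
  {ae mu, forall x, g1 x = h1 x} -> {ae nu, forall y, g2 y = h2 y} ->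
  (\int[mu \x nu]_z (`| plan_density c eps u v z - plan_density c eps g1 g2 z |)%:E
   = \int[mu \x nu]_z (`| plan_density c eps u v z - plan_density c eps h1 h2 z |)%:E)%E.
Proof.
move=> mu_ mv mh1 mh2 gh1 gh2.
have mD (w z : X -> R) : measurable_fun setT w -> measurable_fun setT z ->
    measurable_fun setT
      (fun t => (`| plan_density c eps u v t - plan_density c eps w z t |)%:E).
  move=> mw mz; apply/measurable_EFinP; apply: measurableT_comp => //.
  by apply: measurable_funB; exact: measurable_plan_density.
rewrite !fubini_tonelli1//; try by [exact: mD|move=> t; rewrite lee_fin].
apply: ae_eq_integral => //.
- by apply: measurable_fun_fubini_tonelli_F; [exact: mD|move=> t; rewrite lee_fin].
- by apply: measurable_fun_fubini_tonelli_F; [exact: mD|move=> t; rewrite lee_fin].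
apply: filterS gh1 => x gx _; rewrite /fubini_F.
apply: ae_eq_integral => //.
- exact: (measurableT_comp (mD _ _ mg1 mg2) (pair1_measurable x)).
- exact: (measurableT_comp (mD _ _ mh1 mh2) (pair1_measurable x)).
by apply: filterS gh2 => y gy _; rewrite /plan_density/= gx gy.
Qed.

End schroedinger.

(** * Choice of the weight, the cones and the constants *)

Theorem theorem1p2 (R : realType) (d : measure_display) (X : measurableType d)
  (dX : X -> X -> R) (x0 : X)
  (mu nu : probability X R) (eps : R) (c : X * X -> R)
  (g1s g2s : X -> R) (p delta : R) :
  polish_borel dX ->
  0 < eps ->
  (forall z, 0 <= c z) ->
  measurable_fun setT c ->
  (\int[mu \x nu]_z (c z)%:E < +oo)%E ->
  0 < p -> 0 < delta ->
  (ereal_sup [set (c z)%:E | z in ball_r dX x0 r `*` ball_r dX x0 r]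
     * ((r `^ p)^-1)%:E)%E @[r --> +oo] --> 0%E ->
  (Num.max (fine (mu (~` ball_r dX x0 r))) (fine (nu (~` ball_r dX x0 r)))
     / expR (- r `^ (p + delta))) @[r --> +oo] --> (0 : R) ->
  (* g1*, g2* : positive measurable solutions of the Schroedinger equations *)
  (forall x, 0 < g1s x) -> (forall y, 0 < g2s y) ->
  measurable_fun setT g1s -> measurable_fun setT g2s ->
  {ae mu, forall x, g1s x = T_nu nu c eps g2s x} ->
  {ae nu, forall y, g2s y = T_mu mu c eps g1s y} ->
  exists (m1 m2 : R) (alpha1 alphat1 : R -> R)
         (m1' m2' : R) (alpha2 alphat2 : R -> R) (A kappa : R),
    [/\ 0 < m1 <= m2, tail_function alpha1, tail_function alphat1,
        (0 < mu (ball_r dX x0 m1))%E & (forall r, 0 < r -> 0 < alpha1 r)] /\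
    [/\ 0 < m1' <= m2', tail_function alpha2, tail_function alphat2,
        (0 < nu (ball_r dX x0 m1'))%E & (forall r, 0 < r -> 0 < alpha2 r)] /\
    0 < A /\ 0 < kappa < 1 /\
    forall n : nat,
      (hilbert_dist mu (coneG mu (ball_r dX x0) m1 m2 alpha1 alphat1)
          g1s (sinkhorn mu nu c eps n).1
       + hilbert_dist nu (coneG nu (ball_r dX x0) m1' m2' alpha2 alphat2)
          g2s (sinkhorn mu nu c eps n).2
       <= (A * kappa ^+ n)%:E)%E /\
      (\int[mu \x nu]_z
          (`| plan_density c eps (sinkhorn mu nu c eps n).1
                                  (sinkhorn mu nu c eps n).2 z
              - plan_density c eps g1s g2s z |)%:E
       <= (A * kappa ^+ n)%:E)%E.
Proof.
move=> pX eps0 c0 mc _ p0 delta0 Hc Htail g1s0 g2s0 mg1s mg2s g1sE g2sE.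
have [L L0 cL] := cost_le Hc.
(* The rate for which [E^3] is a constant times [exp (a * d(x0, .)^p)]. *)
pose a := 3 / eps.
have a0 : 0 <= a by rewrite divr_ge0// ltW.
have [j1 tmu] : exists j0 : nat, forall t : R, j0%:R <= t ->
    (mu [set x | (t < dX x0 x `^ p)%R] <= (expR (- ((a + 1) * t)))%:E)%E.
  by apply: (tail_le pX p0 delta0 a0 _ Htail) => r; rewrite le_max lexx.
have [j2 tnu] : exists j0 : nat, forall t : R, j0%:R <= t ->
    (nu [set x | (t < dX x0 x `^ p)%R] <= (expR (- ((a + 1) * t)))%:E)%E.
  by apply: (tail_le pX p0 delta0 a0 _ Htail) => r; rewrite le_max lexx orbT.
(* The successor makes [j0] positive: then [m1 > 0], and the tail bound [exp (- (a + 1) * j0)] is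
   below [1], so the ball has positive mass. *)
pose j0 := (maxn j1 j2).+1.
have j10 : (j1 <= j0)%N by rewrite leqW// leq_maxl.
have j20 : (j2 <= j0)%N by rewrite leqW// leq_maxr.
pose E x := expR ((L + dX x0 x `^ p) / eps).
have ms := measurable_dist_powR x0 pX p.
have mE : measurable_fun setT E.
  by apply: measurableT_comp => //; apply: measurable_funM => //; exact: measurable_funD.
have E1 x : 1 <= E x.
  by rewrite -expR0 ler_expR divr_ge0 ?(ltW eps0)// addr_ge0// powR_ge0.
have cE x y : (E x * E y)^-1 <= expR (- c (x, y) / eps).
  rewrite -expRD -expRN ler_expR mulNr lerN2 -mulrDl ler_pM2r ?invr_gt0//.
  by have := cL x y; lra.
pose K := expR (a * L).
have K0 : 0 <= K by exact: expR_ge0.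
have E3 x : E x ^+ 3 = K * expR (a * dX x0 x `^ p).
  by rewrite -expRM_natl -expRD; congr expR; rewrite /a; field; rewrite gt_eqF.
pose C := expR (a * j0%:R) + 2 * expR a.
have C0 : 0 <= C by rewrite addr_ge0 ?mulr_ge0 ?expR_ge0.
have mom (m : probability X R) (j : nat) : (j <= j0)%N ->
    (forall t : R, j%:R <= t ->
      (m [set x | (t < dX x0 x `^ p)%R] <= (expR (- ((a + 1) * t)))%:E)%E) ->
    [/\ m.-integrable setT (EFin \o (fun x => E x ^+ 3)),
        \int[m]_x (E x ^+ 3) <= K * C & (0 < m (ball_r dX x0 (j0%:R `^ p^-1)))%E].
  move=> jj0 tm.
  have i1 : (\int[m]_x (1 : R)%:E <= 1%:E)%E.
    by rewrite integral_cst// mul1e; apply: probability_le1.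
  have tail i : (j0 <= i)%N ->
      (\int[m]_(x in [set x | (i%:R < dX x0 x `^ p)%R]) (1 : R)%:E <=
        (expR (- ((a + 1) * i%:R)) * 1)%:E)%E.
    move=> j0i; rewrite integral_cst ?mul1e ?mulr1; last exact: measurable_level.
    by apply: tm; rewrite ler_nat (leq_trans jj0).
  have := @exponential_moment_le _ _ _ m _ (fun=> 1) a 1 j0 ms (measurable_cst _)
    (fun=> ler01) a0 ler01 i1 tail.
  under eq_integral do rewrite mul1r; rewrite -/C mulr1 => M.
  have ie : m.-integrable setT (EFin \o (fun x => expR (a * dX x0 x `^ p))).
    apply/integrableP; split.
      by apply/measurable_EFinP/measurableT_comp => //; exact: measurable_funM.
    under eq_integral do rewrite /= ger0_norm ?expR_ge0//.
    by apply: le_lt_trans M _; exact: ltry.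
  have E3' : (fun x => E x ^+ 3) = (fun x => K * expR (a * dX x0 x `^ p)).
    exact/funext.
  split.
  - by rewrite E3'; exact: igrZ.
  - rewrite E3' RintZ// ler_wpM2l// -lee_fin; apply: le_trans M.
    by rewrite /Rintegral fineK//; exact: (integrable_fin_num measurableT ie).
  rewrite lt_neqAle measure_ge0 andbT; apply/eqP => m0.
  have mB : measurable (ball_r dX x0 (j0%:R `^ p^-1)).
    by rewrite -[ball_r _ _ _]setCK; apply: measurableC; rewrite ball_setC//;
      exact: measurable_level.
  have := tm j0%:R; rewrite ler_nat => /(_ jj0); rewrite -ball_setC//.
  rewrite probability_setC// -m0 sube0 lee_fin leNgt expR_lt1 oppr_lt0.
  by rewrite mulr_gt0// ltr_wpDl.
have [imu muJ mu0] := mom mu j1 j10 tmu.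
have [inu nuJ nu0] := mom nu j2 j20 tnu.
have [Q [h1 [h2 [JQ [h1E h2E] [ah1 ah2] g1h1 g2h2]]]] :=
  schroedinger_exact eps0 c0 mc mE E1 imu muJ inu nuJ cE g1s0 g2s0 mg1s mg2s g1sE g2sE.
have Q1 : 1 <= Q by exact: (Q_ge1 mE E1 imu muJ).
have Q0 : 0 < Q by exact: lt_le_trans Q1.
have be0 := weight_cst_gt0 mE E1 imu muJ Q1.
have be1 := weight_cst_le1 mE E1 imu muJ Q1.
have be01 : 0 < weight_cst (K * C) Q <= 1 by rewrite be0.
have ga01 := contr_cst_itv mE E1 imu muJ Q1.
have [ga0 _] := andP ga01.
have [A1 A10 HA1] := sinkhorn_L1_rate eps0 c0 mc mE E1 imu muJ inu nuJ cE JQ h1E h2E ah1 ah2.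
pose th n := Q / weight_cst (K * C) Q * contr_cst (K * C) Q ^+ n.
have th0 n : 0 <= th n.
  by rewrite mulr_ge0 ?exprn_ge0 ?(ltW ga0)// divr_ge0// ltW.
pose m1 := j0%:R `^ p^-1 : R.
have m10 : 0 < m1 by exact: powR_gt0.
pose al (r : R) := expR (- ((a + 1) * r `^ p)).
(* The constant [K * C] serves both as [J] and as the cone constant: the marginals (with density
   [1]) and the elements of the cone obey the same slicing estimate. *)
have FE (m : probability X R) f : coneF m (ball_r dX x0) m1 m1 al (fun=> 0) f ->
    {ae m, forall x, 0 <= f x} /\
    m.-integrable setT (EFin \o (fun x => Num.max (f x) 0 * E x ^+ 3)) /\
    \int[m]_x (Num.max (f x) 0 * E x ^+ 3) <= (K * C) * \int[m]_x (Num.max (f x) 0).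
  move=> /(coneF_moment pX p0 a0)[f0 [ie le]].
  have H : (fun x => Num.max (f x) 0 * E x ^+ 3) =
      (fun x => K * (Num.max (f x) 0 * expR (a * dX x0 x `^ p))).
    by apply/funext => x; rewrite E3 mulrCA.
  split=> //; rewrite H; split; first exact: igrZ.
  by rewrite RintZ// -mulrA ler_wpM2l.
have KC0 : 0 <= K * C by exact: mulr_ge0.
(* Twice the factor [4 * Q * (K * C)] of the Hilbert bound, once per marginal, times the initial
   radius. *)
pose A2 := 8 * (Q / weight_cst (K * C) Q) * Q * (K * C).
have A20 : 0 <= A2.
  rewrite /A2; apply: mulr_ge0 => //; apply: mulr_ge0; last exact: ltW.
  by apply: mulr_ge0 => //; rewrite divr_ge0// ltW.
exists m1, m1, al, (fun=> 0), m1, m1, al, (fun=> 0), (A1 + A2), (contr_cst (K * C) Q).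
have tal : tail_function al by apply: tail_function_exp => //; exact: ltr_wpDl.
have t0 : tail_function (fun=> 0 : R) by split=> //; exact: cvg_cst.
have al0 (r : R) : 0 < r -> 0 < al r by move=> _; exact: expR_gt0.
split; first by split=> //; rewrite m10 lexx.
split; first by split=> //; rewrite m10 lexx.
split; first exact: ltr_wpDr.
split=> // n.
have gn0 : 0 <= contr_cst (K * C) Q ^+ n by rewrite exprn_ge0// ltW.
have [[lam1 H1] [lam2 H2]] := sinkhorn_log_rate eps0 c0 mc mE E1 imu muJ inu nuJ cE JQ h1E h2E ah1 ah2 n.
have [[t1 _] [t2 _]] := sinkhorn_admissible eps0 c0 mc mE E1 imu muJ inu nuJ cE JQ n.
have [th1 _] := ah1; have [th2 _] := ah2.
split.
  have D1 := hilbert_dist_tempered E1 imu Q0 KC0 (FE mu) t1 th1 mg1s g1h1 (th0 n) be01 H1.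
  have D2 := hilbert_dist_tempered E1 inu Q0 KC0 (FE nu) t2 th2 mg2s g2h2 (th0 n) be01 H2.
  apply: (le_trans (leeD D1 D2)); rewrite -EFinD lee_fin [leRHS]mulrDl.
  apply: (@le_trans _ _ (A2 * contr_cst (K * C) Q ^+ n)).
    by rewrite le_eqVlt; apply/orP; left; apply/eqP; rewrite /A2 /th; ring.
  by rewrite lerDr mulr_ge0// ltW.
rewrite (plan_density_ae eps mc mg1s mg2s (h1 := h1) (h2 := h2))//.
- apply: (le_trans (HA1 n)); rewrite lee_fin mulrDl lerDl.
  exact: mulr_ge0.
- by case: t1.
- by case: t2.
- by case: th1.
- by case: th2.
Qed.
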